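(* Let $C\subseteq C_{\hat p}$ be a cut which is a sub-semiring of ${}^*\mathbb N$ (closed under addition and multiplication, containing $0$ and $1$). Then $\mathbb R^C:=f_{\overline{\mathbb Q}}^{-1}[C]$ is a real-closed field whose ordering is the relation $\le$. In particular $\mathbb R^\delta:=f_{\overline{\mathbb Q}}^{-1}[C_{\hat p}]$ is a real-closed field.
   Context: Let $\mathcal F$ be a countably incomplete ultrafilter on a set $I$, ${}^*\mathbb N=\mathbb N^I/\mathcal F$ (with $\mathbb N\subseteq{}^*\mathbb N$), and call a set internal if it lies in ${}^*A$ for some $A$ in the superstructure $V(\mathbb N)$, where $*$ is the elementary embedding induced by the ultrapower. Let $\hat p\in{}^*\mathbb N\setminus\mathbb N$ be a nonstandard prime and $\mathbb F_{\hat p}=\{\hat n:\hat n<\hat p\}$ with operations modulo $\hat p$. Standing assumptions: $\mathbb F_{\hat p}$ contains a subfield isomorphic to the field $\overline{\mathbb Q}\cap\mathbb R$ of real algebraic numbers, and $\mathbb F_{\hat p}$ contains no square root of $-1$. For $a\in\mathbb F_{\hat p}$ let $|a|=\min(a,\hat p-a)$. Define the internal function $f_{\overline{\mathbb Q}}:\mathbb F_{\hat p}\to{}^*\mathbb N$ by letting $f_{\overline{\mathbb Q}}(x)$ be the minimum of $n+\lceil\log_2\max(m,k)\rceil$ over all $n,m,k\in{}^*\mathbb N$ with $n\ge1$, $k\ne0$ in $\mathbb F_{\hat p}$, such that $kx$ is an eigenvalue of some internal $n\times n$ matrix over $\mathbb F_{\hat p}$ all of whose entries have absolute value at most $m$.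 For $\hat n\in{}^*\mathbb N$ let $[\hat n]=\{\hat m\in{}^*\mathbb N:\hat m<\hat n\}$. Let $\phi_2(\hat n)$ be: for all $x,y\in f_{\overline{\mathbb Q}}^{-1}[[\hat n]]$ there is $z\in\mathbb F_{\hat p}$ with $x^2+y^2=z^2$; for odd standard $d>1$ let $\phi_d(\hat n)$ be: for all $a_0,\dots,a_{d-1}\in f_{\overline{\mathbb Q}}^{-1}[[\hat n]]$ there is $x\in\mathbb F_{\hat p}$ with $x^d+\sum_{i<d}a_ix^i=0$. For each $d\in\{2,3,5,7,9,\dots\}$ the set of $\hat n$ satisfying $\phi_d$ is internal, downward closed, contains $\mathbb N$ and omits $\hat p$; let $\hat n_d$ be its maximum. Define $C_{\hat p}=\bigcap_{d\in\{2,3,5,7,\dots\},\,i\ge1}\,[\lceil\hat n_d^{1/i}\rceil]$ (the ceiling of the $i$-th root taken internally). A cut is a downward-closed subset of ${}^*\mathbb N$. For $a,b\in\mathbb F_{\hat p}$, $a\le b$ means that $b-a=x^2$ for some $x\in\mathbb F_{\hat p}$. *)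

(* Defs.v *)
From HB Require Import structures.
From mathcomp Require Import all_boot all_order all_algebra.
From mathcomp Require Import boolp classical_sets filter.
From mathcomp Require Import realalg.

Set Implicit Arguments.
Unset Strict Implicit.
Unset Printing Implicit Defensive.

Import GRing.Theory Num.Theory.
Import Quotient.

Local Open Scope classical_set_scope.

Definition countably_incomplete (I : Type) (F : set_system I) : Prop :=
  exists A : nat -> set I, (forall n, F (A n)) /\ ~ F (\bigcap_n A n).

Section Ultrapower.
Variables (I : Type) (F : set_system I) (FU : UltraFilter F).

Definition ae_eq (A : Type) (u v : {classic (I -> A)}) : bool :=
  `[< F [set i | u i = v i] >].

Lemma ae_eq_equiv (A : Type) : equiv_class_of (@ae_eq A).
Proof.
split=> [u|u v|v u w].
- apply/asboolP; apply: filterS filterT => i _ //=.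
- by apply/asboolP/asboolP; apply: filterS => i /= ->.
- move=> /asboolP uv /asboolP vw; apply/asboolP.
  by apply: filterS2 uv vw => i /= -> ->.
Qed.

Canonical ae_eq_rel (A : Type) := EquivRelPack (ae_eq_equiv A).

Definition upow (A : Type) := {eq_quot @ae_eq_rel A}%qT.
HB.instance Definition _ (A : Type) := Choice.on (upow A).
HB.instance Definition _ (A : Type) := EqQuotient.on (upow A).

Definition ucls (A : Type) (u : I -> A) : upow A := (\pi_(upow A) u)%qT.

Definition urep (A : Type) (x : upow A) : I -> A := repr x.

Definition star (A : Type) (a : A) : upow A := ucls (fun=> a).

(* An element of upow (A -> B) is an internal function from *A to *B; uapp   *)
(* is its evaluation. In particular star f, for f : A -> B, is the           *)
(* nonstandard extension of f.                                               *)
Definition uapp (A B : Type) (f : upow (A -> B)) (x : upow A) : upow B :=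
  ucls (fun i => urep f i (urep x i)).

Definition uholds (b : upow bool) : bool := `[< F [set i | urep b i] >].

Local Notation "f <@> x" := (uapp f x) (at level 40, left associativity).

Definition hnat := upow nat.
HB.instance Definition _ := Choice.on hnat.
HB.instance Definition _ := EqQuotient.on hnat.

Definition hadd (x y : hnat) : hnat := star addn <@> x <@> y.
Definition hsub (x y : hnat) : hnat := star subn <@> x <@> y.
Definition hmul (x y : hnat) : hnat := star muln <@> x <@> y.
Definition hexp (x y : hnat) : hnat := star expn <@> x <@> y.
Definition hmod (x y : hnat) : hnat := star modn <@> x <@> y.
Definition hmin (x y : hnat) : hnat := star minn <@> x <@> y.
Definition hmax (x y : hnat) : hnat := star maxn <@> x <@> y.
Definition hceil_log2 (x : hnat) : hnat := star (up_log 2) <@> x.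
Definition hle (x y : hnat) : bool := uholds (star leq <@> x <@> y).
Definition hlt (x y : hnat) : bool := uholds (star (fun a b => a < b) <@> x <@> y).
Definition hprime (x : hnat) : bool := uholds (star prime <@> x).

(* Both default to 0 when the extremum does not exist.                       *)
Definition hleast (S : set hnat) : hnat :=
  xget (star 0) [set x | S x /\ forall y, S y -> hle x y].
Definition hgreatest (S : set hnat) : hnat :=
  xget (star 0) [set x | S x /\ forall y, S y -> hle y x].

Definition hceil_root (n : hnat) (i : nat) : hnat :=
  hleast [set r | hle n (hexp r (star i))].

Definition is_cut (C : set hnat) : Prop :=
  forall x y, hle x y -> C y -> C x.

Definition is_subsemiring (C : set hnat) : Prop :=
  [/\ C (star 0), C (star 1),
      forall x y, C x -> C y -> C (hadd x y) &
      forall x y, C x -> C y -> C (hmul x y)].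

Lemma ucls_eq (A : Type) (u v : I -> A) :
  ucls u = ucls v <-> F [set i | u i = v i].
Proof. by split=> [/eqmodP/asboolP//|uv]; apply/eqmodP/asboolP. Qed.

Lemma urepK (A : Type) (x : upow A) : ucls (urep x) = x.
Proof. exact: reprK. Qed.

Lemma urep_cls (A : Type) (u : I -> A) : F [set i | urep (ucls u) i = u i].
Proof. by apply/ucls_eq; rewrite urepK. Qed.

Lemma uappE (A B : Type) (f : I -> A -> B) (u : I -> A) :
  ucls f <@> ucls u = ucls (fun i => f i (u i)).
Proof.
apply/ucls_eq; apply: filterS2 (urep_cls f) (urep_cls u) => i /= -> -> //.
Qed.

Lemma uholdsE (b : I -> bool) : uholds (ucls b) = `[< F [set i | b i] >].
Proof.
apply: asbool_equiv_eq.
by split; apply: filterS2 (urep_cls b) => i /= ->.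
Qed.

Section PrimeField.
Variable p : hnat.

(* Primality is only a parameter of the type so that the field instance can  *)
(* be found by unification.                                                  *)
Record Fp (p_prime : hprime p) := MkFp { Fp_val : hnat; _ : hlt Fp_val p }.

Variable p_prime : hprime p.
Local Notation K := (Fp p_prime).
HB.instance Definition _ := [isSub for @Fp_val p_prime].
HB.instance Definition _ := [Choice of K by <:].

Lemma prime_ae : F [set i | prime (urep p i)].
Proof.
move: p_prime; rewrite -[p in hprime p]urepK /hprime /star uappE uholdsE.
by move/asboolP.
Qed.

Lemma hltE (u : I -> nat) : hlt (ucls u) p <-> F [set i | u i < urep p i].
Proof.
by rewrite -[p in hlt _ p]urepK /hlt /star !uappE uholdsE; split=> /asboolP.
Qed.

Lemma hmodE (u : I -> nat) :
  hmod (ucls u) p = ucls (fun i => u i %% urep p i).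
Proof. by rewrite -[p in hmod _ p]urepK /hmod /star !uappE. Qed.

Lemma hmod_ltp (x : hnat) : hlt (hmod x p) p.
Proof.
rewrite -(urepK x) hmodE; apply/hltE.
by apply: filterS prime_ae => i /= /prime_gt0 ?; rewrite ltn_mod.
Qed.

Definition inFp (x : hnat) : K := MkFp p_prime (hmod_ltp x).

Definition Fadd (x y : K) : K := inFp (hadd (Fp_val x) (Fp_val y)).
Definition Fopp (x : K) : K := inFp (hsub p (Fp_val x)).
Definition Fmul (x y : K) : K := inFp (hmul (Fp_val x) (Fp_val y)).
Definition Finv (x : K) : K :=
  if x == inFp (star 0) then inFp (star 0) else
  inFp (star (fun a q => (egcdn a q).1) <@> Fp_val x <@> p).

Lemma FpP (x : K) :
  exists2 u, x = inFp (ucls u) & F [set i | u i < urep p i].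
Proof.
exists (urep (Fp_val x)); last by apply/hltE; rewrite urepK; exact: (valP x).
apply: val_inj => /=; rewrite hmodE -[LHS]urepK; apply/ucls_eq.
have /hltE : hlt (ucls (urep (Fp_val x))) p by rewrite urepK; exact: (valP x).
by apply: filterS => i /= ?; rewrite modn_small.
Qed.

Lemma inFp_eq (u v : I -> nat) :
  F [set i | u i %% urep p i = v i %% urep p i] <->
  inFp (ucls u) = inFp (ucls v).
Proof.
split=> [uv|/(congr1 val)/=]; last by rewrite !hmodE => /ucls_eq.
by apply: val_inj => /=; rewrite !hmodE; apply/ucls_eq.
Qed.

Lemma FaddE (u v : I -> nat) :
  Fadd (inFp (ucls u)) (inFp (ucls v)) = inFp (ucls (fun i => u i + v i)).
Proof.
rewrite /Fadd /= !hmodE /hadd /star !uappE; apply/inFp_eq.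
by apply: filterS filterT => i _ /=; rewrite modnDm.
Qed.

Lemma FmulE (u v : I -> nat) :
  Fmul (inFp (ucls u)) (inFp (ucls v)) = inFp (ucls (fun i => u i * v i)).
Proof.
rewrite /Fmul /= !hmodE /hmul /star !uappE; apply/inFp_eq.
by apply: filterS filterT => i _ /=; rewrite modnMm.
Qed.

Lemma inFp_elim (P : K -> Prop) :
  (forall u, P (inFp (ucls u))) -> forall x, P x.
Proof. by move=> Pu x; have [u -> _] := FpP x. Qed.

Lemma inFp_ext (u v : I -> nat) :
  (forall i, u i = v i) -> inFp (ucls u) = inFp (ucls v).
Proof. by move=> uv; congr (inFp (ucls _)); apply/funext. Qed.

Lemma FaddA : associative Fadd.
Proof.
elim/inFp_elim=> u; elim/inFp_elim=> v; elim/inFp_elim=> w.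
by rewrite !FaddE; apply: inFp_ext => i; rewrite addnA.
Qed.

Lemma FaddC : commutative Fadd.
Proof.
elim/inFp_elim=> u; elim/inFp_elim=> v.
by rewrite !FaddE; apply: inFp_ext => i; rewrite addnC.
Qed.

Lemma Fadd0 : left_id (inFp (star 0)) Fadd.
Proof. by elim/inFp_elim=> u; rewrite FaddE. Qed.

Lemma FaddN : left_inverse (inFp (star 0)) Fopp Fadd.
Proof.
move=> x; have [u -> up] := FpP x.
have subpE v : hsub p (ucls v) = ucls (fun i => urep p i - v i).
  by rewrite -[p in LHS]urepK /hsub /star !uappE.
rewrite /Fopp /= hmodE subpE FaddE.
apply/inFp_eq; apply: filterS up => i /= up.
by rewrite (modn_small up) subnK 1?ltnW // modnn mod0n.
Qed.

HB.instance Definition _ :=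
  GRing.isZmodule.Build K FaddA FaddC Fadd0 FaddN.

Lemma FmulA : associative Fmul.
Proof.
elim/inFp_elim=> u; elim/inFp_elim=> v; elim/inFp_elim=> w.
by rewrite !FmulE; apply: inFp_ext => i; rewrite mulnA.
Qed.

Lemma FmulC : commutative Fmul.
Proof.
elim/inFp_elim=> u; elim/inFp_elim=> v.
by rewrite !FmulE; apply: inFp_ext => i; rewrite mulnC.
Qed.

Lemma Fmul1 : left_id (inFp (star 1)) Fmul.
Proof.
by elim/inFp_elim=> u; rewrite FmulE; apply: inFp_ext => i; rewrite mul1n.
Qed.

Lemma FmulDl : left_distributive Fmul Fadd.
Proof.
elim/inFp_elim=> u; elim/inFp_elim=> v; elim/inFp_elim=> w.
by rewrite !(FaddE, FmulE); apply: inFp_ext => i; rewrite mulnDl.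
Qed.

Lemma Fone_neq0 : inFp (star 1) != inFp (star 0).
Proof.
apply/eqP=> /inFp_eq H; apply: (@filter_not_empty _ F).
apply: filterS2 prime_ae H => i /= /prime_gt1 pi.
by rewrite !modn_small // ltnW.
Qed.

HB.instance Definition _ :=
  GRing.Zmodule_isComNzRing.Build K FmulA FmulC Fmul1 FmulDl Fone_neq0.

Lemma FmulV (x : K) : (x != 0)%R -> (Finv x * x = 1)%R.
Proof.
have [u -> up] := FpP x => u0.
rewrite -[LHS]/(Fmul _ _) /Finv ifN //=; move/eqP in u0; rewrite hmodE.
have invE v : star (fun a q => (egcdn a q).1) <@> ucls v <@> p =
              ucls (fun i => (egcdn (v i) (urep p i)).1).
  by rewrite -[p in LHS]urepK /star !uappE.
rewrite invE FmulE.
apply/inFp_eq.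
have nz : F [set i | u i != 0].
  have [//|H] := in_ultra_setVsetC [set i | u i != 0] FU.
  exfalso; apply: u0; apply/inFp_eq; apply: filterS H => i /= /negP.
  by rewrite negbK => /eqP ->.
apply: filterS3 prime_ae up nz => i /= pi ui u0i.
rewrite (modn_small ui); case: egcdnP => [|a b ab _ /=]; first by rewrite lt0n.
rewrite ab modnMDl (eqP (_ : coprime (u i) (urep p i))) //.
by rewrite coprime_sym prime_coprime // gtnNdvd // lt0n.
Qed.

Lemma FmulV0 : Finv 0%R = 0%R.
Proof. by rewrite /Finv eqxx. Qed.

HB.instance Definition _ := GRing.ComNzRing_isField.Build K FmulV FmulV0.

Local Open Scope ring_scope.

Definition Fle (a b : K) : Prop := exists x : K, b - a = x ^+ 2.

Definition habs (a : hnat) : hnat := hmin a (hsub p a).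

Definition hentry (M : upow (nat -> nat -> nat)) (a b : hnat) : hnat :=
  M <@> a <@> b.

(* An internal n x n matrix over F_p is the restriction to [n] x [n] of an   *)
(* internal function *N -> *N -> *N whose values there are below p.          *)
Definition internal_mx (n : hnat) (M : upow (nat -> nat -> nat)) : Prop :=
  forall a b, hlt a n -> hlt b n -> hlt (hentry M a b) p.

(* 'F_q is Z/qZ only when q is prime, which suffices since p is prime.       *)
Definition eigenvalue_mod (q n : nat) (M : nat -> nat -> nat) (l : nat) :
    bool :=
  eigenvalue (\matrix_(i < n, j < n) (M i j)%:R : 'M['F_q]_n) l%:R.

Definition heigenvalue (n : hnat) (M : upow (nat -> nat -> nat)) (x : K) :
    bool :=
  uholds (star eigenvalue_mod <@> p <@> n <@> M <@> Fp_val x).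

Definition fQbar (x : K) : hnat :=
  hleast [set v | exists n m k M,
    [/\ hle (star 1%N) n /\ inFp k != 0,
        internal_mx n M,
        forall a b, hlt a n -> hlt b n -> hle (habs (hentry M a b)) m,
        heigenvalue n M (inFp k * x) &
        v = hadd n (hceil_log2 (hmax m k))]].

Definition phi2 (n : hnat) : Prop :=
  forall x y : K, hlt (fQbar x) n -> hlt (fQbar y) n ->
  exists z : K, x ^+ 2 + y ^+ 2 = z ^+ 2.

Definition phi_odd (d : nat) (n : hnat) : Prop :=
  forall a : 'I_d -> K, (forall i, hlt (fQbar (a i)) n) ->
  exists x : K, x ^+ d + \sum_(i < d) a i * x ^+ i = 0.

Definition phi (d : nat) : hnat -> Prop :=
  if d == 2%N then phi2 else phi_odd d.

Definition phi_index (d : nat) : bool := (d == 2%N) || (odd d && (1 < d)%N).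

Definition nhat (d : nat) : hnat := hgreatest [set n | phi d n].

Definition Cp : set hnat :=
  [set x | forall d i : nat, phi_index d -> (1 <= i)%N ->
           hlt x (hceil_root (nhat d) i)].

Definition RC (C : set hnat) : set K := fQbar @^-1` C.

End PrimeField.
End Ultrapower.

Arguments RC {I F FU p} p_prime C.

(* The subset S of K, with the operations of K, is a real-closed field       *)
(* ordered by le: it is the image of a real-closed field under a (necessarily *)
(* injective) ring morphism that transports its order to le.                 *)
Definition is_real_closed_field (K : fieldType) (S : set K)
    (le : K -> K -> Prop) : Prop :=
  exists (R : rcfType) (g : {rmorphism R -> K}),
    range g = S /\ forall x y : R, (x <= y)%R <-> le (g x) (g y).

(* Main.v *)
Require Import Defs.
From HB Require Import structures.
From mathcomp Require Import all_boot all_order all_algebra all_fingroup.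
From mathcomp Require Import all_solvable all_field.
From mathcomp Require Import boolp classical_sets filter.
From mathcomp Require Import polyrcf realalg zify ring lra.

(* An element x of a field has complexity at most N when k x, for some nonzero
   integer k <= 2^N, is an eigenvalue of an integer matrix of size at most N
   with entries at most 2^N. Tensor products, block companion matrices and the
   reversed characteristic polynomial show that sums, products, inverses and
   roots of monic polynomials of fixed degree d have complexity at most
   (N + 2)^e with e depending on d only. These bounds hold in every F_q, so
   they transfer to the ultraproduct, and f^-1[C] is a subfield of F_p closed
   under the roots that exist in F_p. As F_p has no square root of -1, each of
   its elements is plus or minus a square; since C lies below every n_d, sums of
   squares of f^-1[C] are squares and its polynomials of odd degree have roots.
   By Artin-Schreier (the Galois group of a splitting field over such a field is
   a 2-group, of order at most 2 because every element of a quadratic extension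
   is a square), f^-1[C] is real closed.

   C_p is itself a semiring because every n_d is infinite: an element of F_p of
   standard complexity is algebraic over the real algebraic numbers, hence is
   one of them, as F_p contains no square root of -1. *)

Set Implicit Arguments.
Unset Strict Implicit.
Unset Printing Implicit Defensive.

Import Order.TTheory GRing.Theory Num.Theory.
Local Open Scope ring_scope.

(** * Fields with square roots and roots of odd degree polynomials *)

Lemma exists_irreducible_factor (F : fieldType) (p : {poly F}) :
  (1 < size p)%N -> exists2 q, irreducible_poly q & q %| p.
Proof.
have [n] := ubnP (size p); elim: n p => // n IHn p; rewrite ltnS => lepn p_gt1.
have [irr|nirr] := pselect (irreducible_poly p); first by exists p.
have [q /andP[q1 qp] nqp] : exists2 q : {poly F}, (size q != 1) && (q %| p) & ~~ (q %= p).
  apply: contra_notP nirr => H; split=> // q q1 qp.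
  by apply: contra_notT H => nqp; exists q; rewrite ?q1.
have p_neq0 : p != 0 by rewrite -size_poly_gt0 ltnW.
have q_neq0 : q != 0 by apply: contraTneq qp => ->; rewrite dvd0p.
have q_gt1 : (1 < size q)%N by rewrite ltn_neqAle eq_sym q1 size_poly_gt0.
have ltqp : (size q < size p)%N.
  by rewrite ltn_neqAle dvdp_leq // andbT dvdp_size_eqp.
have [r irr_r rq] := IHn q (leq_trans ltqp lepn) q_gt1.
by exists r => //; apply: dvdp_trans qp.
Qed.

(** Adjoin a root of an irreducible factor, then split the cofactor over the larger field. The base
    field varies in the induction, and [baseFieldType] turns the tower back into an extension of
    [F]. *)
Lemma exists_splitting_ext (F : fieldType) (p : {poly F}) : p != 0 ->
  exists (L : fieldExtType F) (zs : seq L),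
    map_poly (in_alg L) p %= \prod_(z <- zs) ('X - z%:P).
Proof.
have [n] := ubnP (size p); elim: n => // n IHn in F p *; rewrite ltnS => lepn p0.
have [p_le1|p_gt1] := leqP (size p) 1.
  exists F^o, [::]; rewrite big_nil -size_poly_eq1 size_map_poly.
  by rewrite eqn_leq p_le1 size_poly_gt0.
have [r irr_r /dvdpP[s Ds]] := exists_irreducible_factor p_gt1.
have [K _ [x rx0 _]] := irredp_FAdjoin irr_r.
have /factor_theorem[q Dq] : root (map_poly (in_alg K) p) x.
  by rewrite Ds rmorphM rootM rx0 orbT.
have q0 : q != 0.
  by apply: contraNneq p0 => q0; rewrite -(map_poly_eq0 (in_alg K)) Dq q0 mul0r.
have [|L [zs Dzs]] := IHn K q _ q0.
  move: lepn; rewrite -(size_map_poly (in_alg K)) Dq.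
  by rewrite size_mul ?polyXsubC_eq0 // size_XsubC addn2.
exists (baseFieldType L : fieldExtType F), (in_alg L x :: zs).
have -> : map_poly (in_alg (baseFieldType L : fieldExtType F)) p
          = map_poly (in_alg L) (map_poly (in_alg K) p).
  by rewrite -map_poly_comp; apply: eq_map_poly => a; apply: baseField_scaleE.
rewrite Dq rmorphM /= big_cons mulrC rmorphB /= map_polyX map_polyC.
exact: eqp_mull.
Qed.

(** The extension found above may be too large; the subfield generated by the roots is the splitting
    field, and [vsproj] moves the roots into it. *)
Lemma exists_splitting_field (F : fieldType) (p : {poly F}) : p != 0 ->
  exists L : splittingFieldType F,
    splittingFieldFor 1 (map_poly (in_alg L) p) {:L}.
Proof.
move=> /exists_splitting_ext[L [zs Dp]].
pose E := [the fieldExtType F of subvs_of <<1 & zs>>%AS].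
pose ys : seq E := map (vsproj <<1 & zs>>%AS) zs.
have valys : map vsval ys = zs.
  rewrite -map_comp map_id_in // => z zzs.
  by rewrite /= vsprojK ?seqv_sub_adjoin.
have split_p : splittingFieldFor 1 (map_poly (in_alg E) p) {:E}.
  exists ys.
    rewrite -(eqp_map (vsval : {rmorphism E -> L})) -map_poly_comp.
    rewrite rmorph_prod (eq_map_poly (g := in_alg L)) //; last first.
      by move=> a; apply: rmorph_alg.
    apply: eqp_trans Dp _; rewrite -[X in \prod_(z <- X) _]valys big_map.
    rewrite (eq_bigr (fun y : E => map_poly vsval ('X - y%:P))) ?eqpxx // => y _.
    by rewrite rmorphB /= map_polyX map_polyC.
  apply/vspaceP=> u; rewrite memvf.
  pose f := linfun (vsval : E -> L).
  have : f u \in (f @: <<1 & ys>>)%VS.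
    have -> : (f @: <<1 & ys>> = <<1 & zs>>)%VS.
      rewrite (aimg_adjoin_seq (f : 'AHom(E, L))) aimg1 -[in RHS]valys.
      by congr <<1 & _>>%VS; apply: eq_map => y; rewrite lfunE.
    by rewrite lfunE; apply: valP.
  by case/memv_imgP=> v ysv; rewrite !lfunE => /val_inj ->.
have ax : SplittingField.axiom E.
  by exists (map_poly (in_alg E) p) => //; apply/polyOver1P; exists p.
by exists (HB.pack_for (splittingFieldType F) E
   (FieldExt_isSplittingField.Build F E ax)).
Qed.

(** Complete the square: an element [y] of [M] outside [K] has a minimal polynomial [X^2 + b X + c]
    over [K], and [y + b / 2] has its square in [K]. *)
Lemma quadratic_subfield_sqr (F : fieldType) (L : fieldExtType F)
    (K M : {subfield L}) : 2%:R != 0 :> L -> (K <= M)%VS -> \dim_K M = 2 ->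
  exists x, [/\ x \in M, x \notin K & x ^+ 2 \in K].
Proof.
move=> two0 sKM dimM.
have [y yM yK] : exists2 y, y \in M & y \notin K.
  apply/subvPn; apply/negP => sMK.
  have eqKM : (K : {vspace L}) = M by apply/eqP; rewrite eqEsubv sKM.
  by move: dimM; rewrite -eqKM divnn adim_gt0.
have sKyM : (<<K; y>> <= M)%VS by apply/FadjoinP.
have deg2 : adjoin_degree K y = 2.
  have deg_gt1 : (1 < adjoin_degree K y)%N.
    rewrite ltn_neqAle eq_sym adjoin_deg_eq1 yK /= adjoin_degreeE.
    by rewrite divn_gt0 ?adim_gt0 // dimvS // subv_adjoin.
  apply/eqP; rewrite eqn_leq deg_gt1 andbT adjoin_degreeE -dimM.
  by rewrite leq_div2r // dimvS.
have Kmin := minPolyOver K y.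
have := minPolyxx K y; have := monic_minPoly K y; have := size_minPoly K y.
rewrite deg2 monicE lead_coefE => sz.
rewrite horner_coef sz => /eqP m2; rewrite !big_ord_recr big_ord0 /= {}m2.
set b := _`_1; set c := _`_0 => y0.
have Kb : b \in K by apply: (polyOverP Kmin).
have Kc : c \in K by apply: (polyOverP Kmin).
have K2 : 2%:R \in K by rewrite rpred_nat.
exists (y + b / 2%:R); split.
- by rewrite rpredD // (subvP sKM) // rpred_div.
- by rewrite rpredDr // rpred_div.
have -> : (y + b / 2%:R) ^+ 2 = (b / 2%:R) ^+ 2 - c.
  apply/eqP; rewrite -subr_eq0; apply/eqP; rewrite -{}y0.
  by field.
by rewrite rpredB // rpredX // rpred_div.
Qed.

Lemma sqrr_gauss (A : comNzRingType) (c d i : A) : i ^+ 2 = -1 ->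
  (c + d * i) ^+ 2 = c ^+ 2 - d ^+ 2 + (c * d *+ 2) * i.
Proof. by move=> i2; rewrite sqrrD exprMn i2; ring. Qed.

(** * Ordered fields with square roots of nonnegative elements and roots in odd degree *)

Section OddSqrt.
Local Open Scope group_scope.
Local Open Scope ring_scope.
Variable R : realFieldType.
Hypothesis sqrtR : forall x : R, 0 <= x -> exists y, y ^+ 2 = x.
Hypothesis oddR :
  forall p : {poly R}, p \is monic -> ~~ odd (size p) -> exists x, root p x.

(** A square root [c + d i] of [a + b i]: with [r] the modulus, [c^2 = (a + r) / 2] and
    [d = b / (2 c)]. If [a + r = 0], then [b = 0], and [c = 0] with [d^2 = - a] serves. *)
Lemma complex_sqrt (a b : R) :
  exists c d, c ^+ 2 - d ^+ 2 = a /\ c * d *+ 2 = b.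
Proof.
have [r0 r0E] := sqrtR (addr_ge0 (sqr_ge0 a) (sqr_ge0 b)).
pose r := `|r0|; have rE : r ^+ 2 = a ^+ 2 + b ^+ 2 by rewrite real_normK ?num_real.
have r_ge0 : 0 <= r by rewrite normr_ge0.
have r_ge : `|a| <= r.
  by rewrite -(@ler_pXn2r _ 2) ?nnegrE // real_normK ?num_real // rE lerDl sqr_ge0.
move: r_ge; rewrite ler_norml => /andP[ra1 ra2].
have [ar0|ar0] := eqVneq (a + r) 0.
  have b0 : b = 0.
    apply/eqP; rewrite -sqrf_eq0; apply/eqP.
    have -> : b ^+ 2 = (r - a) * (a + r) by rewrite -(addKr (a ^+ 2) (b ^+ 2)) -rE; ring.
    by rewrite ar0 mulr0.
  have [|d dE] := sqrtR (_ : 0 <= - a); first by lra.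
  by exists 0, d; rewrite dE b0; split; ring.
have [|c cE] := sqrtR (_ : 0 <= (a + r) / 2%:R); first by lra.
have c0 : c != 0 by rewrite -sqrf_eq0 cE mulf_neq0 // invr_neq0 // pnatr_eq0.
exists c, (b / (2%:R * c)); split; last by field.
have -> : (b / (2%:R * c)) ^+ 2 = (r - a) / 2%:R; last by rewrite cE; field.
have -> : (b / (2%:R * c)) ^+ 2 = b ^+ 2 / (4%:R * c ^+ 2) by field.
rewrite cE -(addKr (a ^+ 2) (b ^+ 2)) -rE.
by field.
Qed.

Lemma pchar_ext0 (L : fieldExtType R) : [pchar L] =i pred0.
Proof. by move=> p; rewrite pchar_lalg pchar_num. Qed.

(** In characteristic 0, [M] is generated by one element, whose minimal polynomial has odd degree
    [\dim M]. It has a root in [R] and is irreducible, hence linear. *)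
Lemma odd_dim_subfield (L : fieldExtType R) (M : {subfield L}) :
  odd (\dim M) -> \dim M = 1%N.
Proof.
move=> oddM; pose x := separable_generator 1 M.
have defM : M = <<1; x>>%VS :> {vspace L}.
  apply: eq_adjoin_separable_generator (sub1v _).
  by apply/separableP => y _; apply: pcharf0_separable (@pchar_ext0 L) _.
have degx : \dim M = adjoin_degree 1 x by rewrite defM dim_Fadjoin dimv1 muln1.
have /polyOver1P[p Dp] := minPolyOver 1 x.
have szp : size p = (\dim M).+1.
  by rewrite -(size_map_poly (in_alg L)) -Dp size_minPoly degx.
have [||a pa] := oddR (p := p).
- by rewrite -(map_monic (in_alg L)) -Dp monic_minPoly.
- by rewrite szp /= oddM.
have dvd : ('X - a%:A%:P) %| minPoly 1 x.
  by rewrite Dp dvdp_XsubCl [root _ _]fmorph_root.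
have := minPoly_irr _ dvd; rewrite polyOverXsubC rpredZ ?mem1v // => /(_ isT).
move=> /orP[] /eqp_size; rewrite size_XsubC ?size_poly1 // size_minPoly degx.
by move=> /esym/eqP; rewrite eqSS => /eqP.
Qed.

Lemma galois_base (L : splittingFieldType R) : galois 1 {:L}.
Proof.
rewrite /galois sub1v normalFieldf andbT.
by apply/separableP => y _; apply: pcharf0_separable (@pchar_ext0 L) _.
Qed.

(** [M] is [R] with a square root of -1 adjoined: some [x] in [M] outside [R] has [x^2 = a] in [R],
    with [a < 0] since otherwise [x] would lie in [R], and dividing [x] by a root of [- a] gives
    [i]. Then [complex_sqrt] applies to the coordinates of [z]. *)
Lemma quadratic_ext_sqrt (L : fieldExtType R) (M : {subfield L}) (z : L) :
  \dim M = 2 -> z \in M -> exists2 w, w \in M & w ^+ 2 = z.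
Proof.
move=> dimM zM.
have two0 : 2%:R != 0 :> L by rewrite ((pcharf0P L).1 (@pchar_ext0 L)).
have dim1M : \dim_(1%AS : {subfield L}) M = 2 by rewrite dimv1 divn1.
have [x [xM x1]] := quadratic_subfield_sqr two0 (sub1v M) dim1M.
case/vlineP=> a xa.
have a_lt0 : a < 0.
  rewrite ltNge; apply/negP => /sqrtR[y ya].
  move: x1; have /eqP : x ^+ 2 = y%:A ^+ 2 by rewrite xa -ya exprZn expr1n.
  by rewrite eqf_sqr => /orP[]/eqP->; rewrite ?rpredN rpredZ // mem1v.
have [|e eE] := sqrtR (_ : 0 <= - a); first by rewrite oppr_ge0 ltW.
have e0 : e != 0 by rewrite -sqrf_eq0 eE oppr_eq0 lt_eqF.
pose i := e^-1 *: x.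
have i2 : i ^+ 2 = - 1.
  by rewrite exprZn xa scalerA exprVn eE invrN mulNr mulVf ?lt_eqF // scaleN1r.
have xi : x = e *: i by rewrite scalerA divff // scale1r.
have iM : i \in M by rewrite rpredZ.
clearbody i.
have i1 : i \notin 1%VS by apply: contra x1 => i1; rewrite xi rpredZ.
have sM : (<<1; i>> <= M)%VS by apply/FadjoinP; split=> //; apply: sub1v.
have deg : adjoin_degree 1 i = 2.
  apply/eqP; rewrite eqn_leq [X in _ && X]ltn_neqAle eq_sym adjoin_deg_eq1 i1 /=.
  rewrite adjoin_degreeE dimv1 divn1 adim_gt0 andbT.
  by rewrite -dimM; apply: dimvS.
have defM : (<<1; i>> = M :> {vspace L})%VS.
  by apply/eqP; rewrite eqEdim sM dimM dim_Fadjoin deg dimv1.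
have /Fadjoin_poly_eq <- : z \in <<1; i>>%VS by rewrite defM.
have := size_Fadjoin_poly 1 i z.
have /polyOver1P[q ->] := Fadjoin_polyOver 1 i z.
rewrite deg size_map_poly => szq.
have [c [d [cd1 cd2]]] := complex_sqrt q`_0 q`_1.
exists (in_alg L c + in_alg L d * i).
  by rewrite rpredD ?rpredM ?rpredZ ?mem1v.
rewrite (@horner_coef_wide _ 2) ?size_map_poly // !big_ord_recr big_ord0 /=.
rewrite !coef_map expr0 expr1 mulr1 add0r -cd1 -cd2.
have sqrE (f : {rmorphism R -> L}) :
    (f c + f d * i) ^+ 2 = f (c ^+ 2 - d ^+ 2) + f (c * d *+ 2) * i.
  by rewrite (sqrr_gauss _ _ i2) rmorphB !rmorphXn rmorphMn rmorphM.
exact: (sqrE (in_alg L)).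
Qed.

(** A Sylow 2-subgroup has a fixed field of odd dimension, so it is the whole Galois group. If the
    order were at least 4, subgroups [H2] in [H1] of index 4 and 2 would give a quadratic extension
    of [fixedField H1] generated by the square root of an element that already has its roots
    there. *)
Lemma splitting_dim_le2 (L : splittingFieldType R) : (\dim {:L} <= 2)%N.
Proof.
have dimL : \dim {:L} = #|'Gal({:L} / 1)|.
  by rewrite -(galois_dim (galois_base L)) dimv1 divn1.
have two0 : 2%:R != 0 :> L by rewrite ((pcharf0P L).1 (@pchar_ext0 L)).
have [H sylH] := Sylow_exists 2 'Gal({:L} / 1)%G.
have sHG := pHall_sub sylH.
have fixH : \dim (fixedField H) = #|'Gal({:L} / 1) : H|.
  by rewrite -(dim_fixed_galois (galois_base L) sHG) dimv1 divn1.
have pG : 2.-group 'Gal({:L} / 1).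
  have idx : #|'Gal({:L} / 1) : H| = 1%N.
    rewrite -fixH; apply: odd_dim_subfield.
    by rewrite fixH odd_2'nat; case/and3P: sylH.
  by rewrite -(index1g sHG idx) (pHall_pgroup sylH).
rewrite dimL (card_pgroup pG).
case logG: (logn _ _) => [|[|k]] //.
have [|H1 [sH1G _ oH1]] := normal_pgroup (r := k.+1) pG (normal_refl _).
  by rewrite logG.
have pH1 := pgroupS sH1G pG.
have [|H2 [sH21 _ oH2]] := normal_pgroup (r := k) pH1 (normal_refl _).
  by rewrite oH1 pfactorK.
have dimF (K : {group gal_of {:L}}) : K \subset 'Gal({:L} / 1) ->
    (\dim (fixedField K) = #|'Gal({:L} / 1)| %/ #|K|)%N.
  by move=> sKG; rewrite divgS // -(dim_fixed_galois (galois_base L) sKG) dimv1 divn1.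
have dimM1 : \dim (fixedField H1) = 2.
  by rewrite dimF // (card_pgroup pG) logG oH1 expnS mulnK // expn_gt0.
have dimM2 : \dim (fixedField H2) = 4.
  rewrite dimF ?(fintype.subset_trans sH21) // (card_pgroup pG) logG oH2.
  by rewrite !expnS mulnA mulnK // expn_gt0.
have sM : (fixedField H1 <= fixedField H2)%VS by apply: fixedFieldS.
have [|x [xM2 /negP xM1]] := quadratic_subfield_sqr two0 sM.
  by rewrite dimM1 dimM2.
move=> /(quadratic_ext_sqrt dimM1)[w wM1 /esym/eqP].
by rewrite eqf_sqr => wx; case: xM1; case/orP: wx => /eqP->; rewrite ?rpredN.
Qed.

(** A root in the splitting field has degree at most 2 over [R], and its minimal polynomial is [p]
    up to a unit. *)
Lemma irreducible_size_le3 (p : {poly R}) : irreducible_poly p -> (size p <= 3)%N.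
Proof.
move=> irr_p; have p_neq0 : p != 0 by apply: irredp_neq0.
have [L [zs Dp defL]] := exists_splitting_field p_neq0.
have [x xzs] : exists x, x \in zs.
  case: zs Dp {defL} => [|x zs _]; last by exists x; rewrite inE eqxx.
  rewrite big_nil -size_poly_eq1 size_map_poly => /eqP p1.
  by case: irr_p; rewrite p1.
have px : root (map_poly (in_alg L) p) x by rewrite (eqp_root Dp) root_prod_XsubC.
have /polyOver1P[q Dq] := minPolyOver 1 x.
have pL : map_poly (in_alg L) p \is a polyOver 1%AS by apply/polyOver1P; exists p.
have := minPoly_dvdp pL px.
rewrite Dq dvdp_map => /(irr_p.2 q).
have szq : size q = (adjoin_degree 1 x).+1.
  by rewrite -(size_map_poly (in_alg L)) -Dq size_minPoly.
rewrite szq eqSS => /(_ isT)/eqp_size <-; rewrite szq ltnS.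
rewrite adjoin_degreeE dimv1 divn1; apply: leq_trans (splitting_dim_le2 L).
exact/dimvS/subvf.
Qed.

Lemma irreducible_quadratic_disc_lt0 (p : {poly R}) :
  irreducible_poly p -> size p = 3 -> p`_1 ^+ 2 - 4%:R * p`_2 * p`_0 < 0.
Proof.
move=> irr_p szp; rewrite ltNge; apply/negP => /sqrtR[s sE].
have c2 : p`_2 != 0.
  by have := irredp_neq0 irr_p; rewrite -lead_coef_eq0 lead_coefE szp.
pose x := (s - p`_1) / (2%:R * p`_2).
have px : root p x.
  rewrite /root horner_coef szp !big_ord_recr big_ord0 /=.
  set e := (X in X == 0).
  have -> : e = (s ^+ 2 - (p`_1 ^+ 2 - 4%:R * p`_2 * p`_0)) / (4%:R * p`_2).
    by rewrite /e /x; field.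
  by rewrite sE subrr mul0r.
have := irr_p.2 ('X - x%:P); rewrite size_XsubC dvdp_XsubCl px.
by move=> /(_ isT isT)/eqp_size; rewrite size_XsubC szp.
Qed.

(** Split off irreducible factors one at a time. A quadratic factor has constant sign because its
    discriminant is negative; the root of a linear factor lies outside [[a, b]], so its values at
    both ends have the same sign. *)
Lemma rootfree_same_sign (p : {poly R}) (a b : R) : a <= b -> p != 0 ->
  (forall x, a <= x <= b -> ~~ root p x) -> 0 < p.[a] * p.[b].
Proof.
move=> leab; have [n] := ubnP (size p); elim: n p => // n IHn p.
rewrite ltnS => lepn p0 noroot.
have [p_le1|p_gt1] := leqP (size p) 1.
  have [c c0 ->] : exists2 c, c != 0 & p = c%:P.
    have pC := size1_polyC p_le1; exists p`_0 => //.
    by apply: contraNneq p0 => p00; rewrite pC p00.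
  by rewrite !hornerC -expr2 lt0r sqrf_eq0 c0 sqr_ge0.
have [q irr_q /dvdpP[r Dr]] := exists_irreducible_factor p_gt1.
have q0 := irredp_neq0 irr_q.
have r0 : r != 0 by apply: contraNneq p0 => r0; rewrite Dr r0 mul0r.
have /(IHn r) /(_ r0) : (size r < n)%N.
  apply: leq_trans lepn; rewrite Dr size_mul // -subn1 -addnBA ?size_poly_gt0 //.
  by rewrite -[X in (X < _)%N]addn0 ltn_add2l subn_gt0; case: irr_q.
have noroot_r x : a <= x <= b -> ~~ root r x.
  by move=> /noroot; rewrite Dr rootM negb_or => /andP[].
have noroot_q x : a <= x <= b -> ~~ root q x.
  by move=> /noroot; rewrite Dr rootM negb_or => /andP[].
move=> /(_ noroot_r) r_pos; rewrite Dr !hornerM mulrACA mulr_gt0 //.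
have := irreducible_size_le3 irr_q; rewrite leq_eqVlt => /orP[/eqP szq|szq].
  have D_lt0 := irreducible_quadratic_disc_lt0 irr_q szq.
  have pos x : 0 < 4%:R * q`_2 * q.[x].
    rewrite horner_coef szq !big_ord_recr big_ord0 /= add0r.
    have -> : 4%:R * q`_2 * (q`_0 * x ^+ 0 + q`_1 * x ^+ 1 + q`_2 * x ^+ 2)
      = (2%:R * q`_2 * x + q`_1) ^+ 2 - (q`_1 ^+ 2 - 4%:R * q`_2 * q`_0) by ring.
    by rewrite subr_gt0 (lt_le_trans D_lt0) // sqr_ge0.
  have := mulr_gt0 (pos a) (pos b); rewrite mulrACA -expr2 pmulr_rgt0 //.
  rewrite lt0r sqr_ge0 sqrf_eq0 andbT.
  by apply: contraTneq (pos a) => ->; rewrite mul0r ltxx.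
have szq2 : size q = 2 by apply/eqP; rewrite eqn_leq -ltnS szq; case: irr_q.
have c1 : q`_1 != 0 by move: q0; rewrite -lead_coef_eq0 lead_coefE szq2.
have qE x : q.[x] = q`_1 * (x - - q`_0 / q`_1).
  by rewrite horner_coef szq2 !big_ord_recr big_ord0 /=; field.
rewrite !qE mulrACA -expr2 pmulr_rgt0; last by rewrite lt0r sqrf_eq0 c1 sqr_ge0.
have : ~~ (a <= - q`_0 / q`_1 <= b).
  by apply: contraL isT => /noroot_q; rewrite /root qE subrr mulr0 eqxx.
rewrite negb_and -!ltNge => /orP[xa|bx].
  by rewrite mulr_gt0 // subr_gt0 // (lt_le_trans xa).
by rewrite -mulrNN mulr_gt0 // oppr_gt0 subr_lt0 // (le_lt_trans leab).
Qed.

Lemma odd_sqrt_real_closed : Num.real_closed_axiom R.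
Proof.
move=> p a b leab /andP[pa pb].
have [->|p0] := eqVneq p 0; first by exists a; rewrite ?lexx ?leab ?root0.
apply: contrapT => noroot.
have : 0 < p.[a] * p.[b].
  apply: rootfree_same_sign => // x axb; apply/negP => px.
  by apply: noroot; exists x.
by rewrite ltNge mulr_le0_ge0.
Qed.

End OddSqrt.

(** * Squares and root-free polynomials in finite fields *)

Lemma finField_sqr_or_opp (F : finFieldType) (x : F) :
  (forall z : F, z ^+ 2 != -1) -> exists y : F, x = y ^+ 2 \/ x = - y ^+ 2.
Proof.
move=> noN1.
(* The nonzero squares and their negatives are disjoint, as a common element would make -1 a square.
   Squaring has fibres of at most two elements, so [Q] is at least half of the nonzero elements, and
   the two sets exhaust them. *)
pose Q := [set y ^+ 2 | y in [set~ (0 : F)]].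
pose NQ := [set - y | y in Q].
have disj : [disjoint Q & NQ].
  rewrite -setI_eq0; apply/eqP/setP => z; rewrite !inE.
  apply/negP => /andP[/imsetP[a a0 ->] /imsetP[_ /imsetP[b b0 ->] ab]].
  rewrite !inE in a0 b0; case/eqP: (noN1 (a / b)).
  by rewrite expr_div_n ab mulNr divff // expf_neq0.
have cardNQ : #|NQ| = #|Q| by rewrite card_imset //; apply: oppr_inj.
have cardF : (#|[set~ (0%R : F)]| <= 2 * #|Q|)%N.
  rewrite -sum1_card (partition_big_imset (fun y => y ^+ 2)) /= -/Q mulnC -sum_nat_const.
  apply: leq_sum => z /imsetP[a a0 ->].
  rewrite sum1dep_card -[2%N]/(1 + 1)%N.
  apply: leq_trans (_ : #|[set a; - a]| <= _)%N; last by rewrite cards2; case: eqP.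
  apply/subset_leq_card/fintype.subsetP => b; rewrite !inE => /andP[_].
  by rewrite eqf_sqr.
have [->|x0] := eqVneq x 0; first by exists 0; left; rewrite expr0n.
have : x \in Q :|: NQ.
  suff -> : Q :|: NQ = [set~ 0] by rewrite !inE.
  apply/eqP; rewrite eqEcard; apply/andP; split.
    apply/fintype.subsetP => z; rewrite !inE.
    move=> /orP[/imsetP[a a0 ->]|/imsetP[_ /imsetP[a a0 ->] ->]];
    by rewrite !inE in a0 *; rewrite ?oppr_eq0 expf_neq0.
  by rewrite cardsU (disjoint_setI0 disj) cards0 subn0 cardNQ addnn -mul2n.
rewrite inE => /orP[/imsetP[a _ ->]|/imsetP[_ /imsetP[a _ ->] ->]]; exists a;
  by [left|right].
Qed.

(** Otherwise [n + 1 = z^2 + 1^2] would make every natural number a square by induction, in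
    particular [q - 1], which is -1. *)
Lemma Fp_sum_sqr_not_sqr (q : nat) : prime q -> (forall z : 'F_q, z ^+ 2 != -1) ->
  exists x y : 'F_q, forall z, x ^+ 2 + y ^+ 2 != z ^+ 2.
Proof.
move=> pr_q noN1; apply: contrapT => H.
have sq n : exists z : 'F_q, n%:R = z ^+ 2.
  elim: n => [|n [z zE]]; first by exists 0; rewrite expr0n.
  apply: contrapT => Hn; apply: H; exists z, 1 => w; apply/eqP => zw.
  by apply: Hn; exists w; rewrite -zw -zE expr1n -natr1.
have [z zE] := sq q.-1; case/eqP: (noN1 z); rewrite -zE.
apply/eqP; rewrite -subr_eq0 opprK natr1 prednK ?prime_gt0 //.
by rewrite (pcharf0 (pchar_Fp pr_q)).
Qed.

(** The map [x - x^d] vanishes at both 0 and 1, so on a finite field it is not injective, hence not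
    surjective; [c] is a value that it misses. *)
Lemma finField_rootfree (F : finFieldType) (d : nat) : (1 < d)%N ->
  exists c : F, forall x, x ^+ d - x + c != 0.
Proof.
move=> d1; pose g (x : F) := x - x ^+ d.
have ninj : ~~ injectiveb g.
  apply/negP => /injectiveP inj; have /eqP := oner_neq0 F; apply; apply: inj.
  by rewrite /g expr1n expr0n eqn0Ngt (ltnW d1) subrr subr0.
have : ~~ [forall c, c \in codom g].
  apply: contra ninj => /forallP surj; apply/injectiveP => a b.
  have /fintype.image_injP inj : #|fintype.image g F| == #|F|.
    by apply/eqP/eq_card => c; rewrite surj inE.
  exact: inj.
move=> /forallPn[c cg]; exists c => x; apply: contra cg => /eqP xc.
apply/codomP; exists x; rewrite /g; apply/eqP; rewrite -subr_eq0 -xc; apply/eqP; ring.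
Qed.

(** Some irreducible factor of [p] vanishes at [y]. It cannot be quadratic: completing its square
    and dividing by a root of minus its discriminant would give a square root of -1 in [K]. A linear
    factor has its root in the image of [h]. *)
Lemma sqr_neqN1_image (R : realFieldType) (K : fieldType) (h : {rmorphism R -> K})
  (sqrtR : forall x : R, 0 <= x -> exists y, y ^+ 2 = x)
  (oddR : forall p : {poly R}, p \is monic -> ~~ odd (size p) -> exists x, root p x) :
  (forall z : K, z ^+ 2 != -1) ->
  forall (p : {poly R}) (y : K), p != 0 -> root (map_poly h p) y -> exists b, y = h b.
Proof.
move=> noN1 p y; have [n] := ubnP (size p); elim: n p => // n IHn p.
rewrite ltnS => lepn p0 py.
have p_gt1 : (1 < size p)%N.
  rewrite ltnNge; apply: contraL py => /size1_polyC pC.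
  rewrite pC map_polyC rootC fmorph_eq0; apply: contraNneq p0 => p00.
  by rewrite pC p00.
have [q irr_q /dvdpP[r Dr]] := exists_irreducible_factor p_gt1.
have q0 := irredp_neq0 irr_q.
have r0 : r != 0 by apply: contraNneq p0 => r0; rewrite Dr r0 mul0r.
have r_lt : (size r < n)%N.
  apply: leq_trans lepn; rewrite Dr size_mul // -subn1 -addnBA ?size_poly_gt0 //.
  by rewrite -[X in (X < _)%N]addn0 ltn_add2l subn_gt0; case: irr_q.
move: py; rewrite Dr rmorphM rootM => /orP[|]; first exact: IHn.
have := irreducible_size_le3 sqrtR oddR irr_q; rewrite leq_eqVlt => /orP[/eqP szq|szq].
  have D_lt0 := irreducible_quadratic_disc_lt0 sqrtR irr_q szq.
  have [|e eE] := sqrtR (- (q`_1 ^+ 2 - 4%:R * q`_2 * q`_0)).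
    by rewrite oppr_ge0 ltW.
  have e0 : h e != 0 by rewrite fmorph_eq0 -sqrf_eq0 eE oppr_eq0 lt_eqF.
  rewrite /root horner_coef size_map_poly szq !big_ord_recr big_ord0 /= !coef_map /=.
  move=> /eqP qy.
  case/eqP: (noN1 ((2%:R * h q`_2 * y + h q`_1) / h e)).
  have := congr1 h eE.
  rewrite rmorphN rmorphB !rmorphXn !rmorphM rmorph_nat /= => {}eE.
  have sqE : (2%:R * h q`_2 * y + h q`_1) ^+ 2 = - (h e ^+ 2).
    transitivity (- (h e ^+ 2) + 4%:R * h q`_2 * 0); last by rewrite mulr0 addr0.
    by rewrite -[in RHS]qy eE; ring.
  by rewrite expr_div_n sqE mulNr divff // expf_neq0.
have szq2 : size q = 2 by apply/eqP; rewrite eqn_leq -ltnS szq; case: irr_q.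
have c1 : q`_1 != 0 by move: q0; rewrite -lead_coef_eq0 lead_coefE szq2.
have hc1 : h q`_1 != 0 by rewrite fmorph_eq0.
rewrite /root horner_coef size_map_poly szq2 !big_ord_recr big_ord0 /= !coef_map /=.
rewrite expr0 mulr1 expr1 add0r addrC addr_eq0 => /eqP qy.
exists (- q`_0 / q`_1); rewrite rmorphM rmorphN fmorphV -qy.
by field.
Qed.

(** * Eigenvalues of small integer matrices *)

(** One exponent [N] controls the size, the denominator and the entries. Integer matrices make the
    estimates below uniform in [F], as the transfer to an ultraproduct requires. *)
Definition small_eig (F : fieldType) (N : nat) (x : F) : Prop :=
  exists n k (M : 'M[int]_n),
    [/\ (n <= N)%N, (k <= 2 ^ N)%N, k%:R != 0 :> F,
        forall i j, `|M i j| <= 2 ^+ N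
      & eigenvalue (map_mx intr M : 'M[F]_n) (k%:R * x)].

Section SmallEig.
Variable F : fieldType.
Implicit Types (x y : F) (N : nat).

Lemma small_eig_le N N' x : (N <= N')%N -> small_eig N x -> small_eig N' x.
Proof.
move=> leN [n [k [M [nN kN k0 MN eigM]]]]; exists n, k, M; split=> //.
- exact: leq_trans leN.
- by apply: leq_trans kN _; rewrite leq_exp2l.
- by move=> i j; apply: le_trans (MN i j) _; rewrite ler_weXn2l // ler1n.
Qed.

(** Arbitrary finite index types are convenient because tensor products are indexed by functions and
    block matrices by pairs. *)
Lemma small_eig_fin (T : finType) (v : T -> F) (A : T -> T -> int) k N x :
  (#|T| <= N)%N -> (k <= 2 ^ N)%N -> k%:R != 0 :> F ->
  (forall s t, `|A s t| <= 2 ^+ N) -> (exists t, v t != 0) ->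
  (forall t, \sum_s v s * (A s t)%:~R = k%:R * x * v t) -> small_eig N x.
Proof.
move=> TN kN k0 AN [t0 vt0] vA.
exists #|T|, k, (\matrix_(i, j) A (enum_val i) (enum_val j)); split=> //.
  by move=> i j; rewrite mxE.
apply/eigenvalueP; exists (\row_i v (enum_val i)).
  apply/rowP => j; rewrite !mxE -vA (reindex _ (onW_bij _ (enum_val_bij T))) /=.
  by apply: eq_bigr => i _; rewrite !mxE.
apply: contraNneq vt0 => /rowP/(_ (enum_rank t0)).
by rewrite !mxE enum_rankK => ->.
Qed.

(** Zero rows and columns bring the matrix to size exactly [N], so that several elements can share
    an index type. *)
Lemma small_eig_pad N x : small_eig N x ->
  exists k (v : 'I_N -> F) (A : 'I_N -> 'I_N -> int),
    [/\ (k <= 2 ^ N)%N, k%:R != 0 :> F, forall s t, `|A s t| <= 2 ^+ N,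
        exists t, v t != 0
      & forall t, \sum_s v s * (A s t)%:~R = k%:R * x * v t].
Proof.
move=> [n [k [M [nN kN k0 MN /eigenvalueP[w wM w0]]]]].
pose v (i : 'I_N) := if insub (i : nat) is Some i' then w 0 i' else 0.
pose A (i j : 'I_N) : int :=
  if (insub (i : nat), insub (j : nat)) is (Some i', Some j') then M i' j' else 0.
have vE (i : 'I_n) : v (widen_ord nN i) = w 0 i.
  by rewrite /v /= valK.
have AE (i j : 'I_n) : A (widen_ord nN i) (widen_ord nN j) = M i j.
  by rewrite /A /= !valK.
exists k, v, A; split=> //.
- move=> s t; rewrite /A; case: (insub (s : nat)) => [s'|]; last first.
    by rewrite normr0 exprn_ge0.
  by case: (insub (t : nat)) => [t'|]; rewrite ?MN // normr0 exprn_ge0.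
- have /rV0Pn[i wi] := w0.
  by exists (widen_ord nN i); rewrite vE.
move=> t; rewrite (bigID (fun s : 'I_N => (s < n)%N)) /=.
rewrite [X in _ + X]big1 ?addr0; last first.
  by move=> s /negPf sn; rewrite /v insubF // mul0r.
rewrite (big_ord_narrow nN).
have [tn|tn] := ltnP t n; last first.
  rewrite big1 => [|s _]; first by rewrite /v insubF ?mulr0 // ltnNge tn.
  have tF : insub (t : nat) = None :> option 'I_n by rewrite insubF // ltnNge tn.
  by rewrite /A tF; case: (insub _ : option 'I_n) => [?|]; rewrite mulr0.
have -> : t = widen_ord nN (Ordinal tn) by apply: val_inj.
move/rowP: wM => /(_ (Ordinal tn)); rewrite !mxE vE => <-.
by apply: eq_bigr => s _; rewrite vE AE !mxE.
Qed.

(** On a shared eigenvector, sums and products of matrices act by the sums and products of the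
    eigenvalues. The dimension [N ^ d] is polynomial in [N] for fixed [d]. *)
Lemma common_eigenvector N d (a : 'I_d -> F) : (forall i, small_eig N (a i)) ->
  exists (k : 'I_d -> nat) (v : {ffun 'I_d -> 'I_N} -> F)
         (A : 'I_d -> {ffun 'I_d -> 'I_N} -> {ffun 'I_d -> 'I_N} -> int),
    [/\ forall i, (k i <= 2 ^ N)%N, forall i, (k i)%:R != 0 :> F,
        forall i s t, `|A i s t| <= 2 ^+ N, exists t, v t != 0
      & forall i t, \sum_s v s * (A i s t)%:~R = (k i)%:R * a i * v t].
Proof.
move=> Sa; have [k Hk] := choice (fun i => small_eig_pad (Sa i)).
have [w Hw] := choice Hk; have [M H] := choice Hw.
(* Kronecker products: the i-th matrix acts as [M i] on the i-th tensor factor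
   and as the identity on the others. *)
pose G i j (s t : 'I_N) : int := if j == i then M i s t else (s == t)%:R.
exists k, (fun t => \prod_j w j (t j)),
  (fun i s t => \prod_j G i j (s j) (t j)); split.
- by move=> i; have [] := H i.
- by move=> i; have [] := H i.
- move=> i s t; rewrite normr_prod (bigD1 i) //= /G eqxx.
  have [_ _ MN _ _] := H i.
  rewrite -[leRHS]mulr1; apply: ler_pM => //; first exact: prodr_ge0.
  apply: prodr_ile1 => j /negPf ji; rewrite ji normr_ge0 /=.
  by case: (_ == _); rewrite ?normr1 ?normr0.
- have Hv j : exists t, w j t != 0 by have [] := H j.
  have [t wt] := choice Hv.
  by exists (finfun t); apply/prodf_neq0 => j _; rewrite ffunE.
move=> i t.
transitivity (\sum_(s : {ffun 'I_d -> 'I_N})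
                 \prod_j (w j (s j) * (G i j (s j) (t j))%:~R)).
  by apply: eq_bigr => s _; rewrite big_split /= rmorph_prod.
rewrite -(bigA_distr_bigA (fun j s => w j s * (G i j s (t j))%:~R)).
rewrite (bigD1 i) //= [in RHS](bigD1 i) //= mulrA.
congr (_ * _).
  by rewrite /G eqxx; have [_ _ _ _ ->] := H i.
apply: eq_bigr => j /negPf ji; rewrite /G ji (bigD1 (t j)) //= eqxx mulr1.
by rewrite big1 ?addr0 // => s /negPf ->; rewrite mulr0.
Qed.

Lemma small_eig1 N : small_eig N.+1 (1 : F).
Proof.
apply: (@small_eig_fin unit (fun=> 1) (fun _ _ => 1) 1); rewrite ?card_unit ?expn_gt0 //.
- by rewrite oner_eq0.
- by move=> _ _; rewrite normr1 exprn_ege1.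
- by exists tt; rewrite oner_eq0.
- by move=> []; rewrite big_const card_unit /= addr0 !mul1r.
Qed.

Lemma small_eigN1 N : small_eig N.+1 (-1 : F).
Proof.
apply: (@small_eig_fin unit (fun=> 1) (fun _ _ => -1) 1); rewrite ?card_unit ?expn_gt0 //.
- by rewrite oner_eq0.
- by move=> _ _; rewrite normrN1 exprn_ege1.
- by exists tt; rewrite oner_eq0.
- by move=> []; rewrite big_const card_unit /= addr0 !mul1r mulr1.
Qed.


Lemma normr_natM_le (k N : nat) (z : int) :
  (k <= 2 ^ N)%N -> `|z| <= 2 ^+ N -> `|k%:R * z| <= 2 ^+ (N + N).
Proof.
move=> kN zN; rewrite normrM normr_nat exprD ler_pM //.
by rewrite -natrX ler_nat.
Qed.

(** On the common eigenvector, [k 1 * A 0 + k 0 * A 1] acts by [k 0 * k 1 * (x + y)]; its entries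
    are at most [2 ^ (2 N + 1)]. *)
Lemma small_eigD N x y :
  small_eig N x -> small_eig N y -> small_eig (N.+2 ^ 2) (x + y).
Proof.
move=> Sx Sy; pose a (i : 'I_2) := if i == 0 then x else y.
have Sa i : small_eig N (a i) by rewrite /a; case: ifP.
have [k [v [A [kN k0 AN v0 vA]]]] := common_eigenvector Sa.
have le2 : (N + N <= N.+2 ^ 2)%N by nia.
apply: (@small_eig_fin _ v
  (fun s t => (k 1)%:R * A 0 s t + (k 0)%:R * A 1 s t) (k 0%R * k 1%R)%N) => //.
- by rewrite card_ffun !card_ord; nia.
- apply: leq_trans (_ : 2 ^ (N + N) <= _)%N; last by rewrite leq_exp2l.
  by rewrite expnD leq_mul.
- by rewrite natrM mulf_neq0.
- move=> s t; apply: le_trans (ler_normD _ _) _.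
  apply: le_trans (_ : 2 ^+ (N + N).+1 <= _); last first.
    by rewrite ler_weXn2l // ?ler1n //; nia.
  have -> : 2 ^+ (N + N).+1 = 2 ^+ (N + N) + 2 ^+ (N + N) :> int.
    by rewrite exprS; ring.
  by rewrite lerD ?normr_natM_le.
move=> t.
rewrite (eq_bigr (fun s => (k 1)%:R * (v s * (A 0 s t)%:~R) +
                           (k 0)%:R * (v s * (A 1 s t)%:~R))); last first.
  by move=> s _; rewrite rmorphD !rmorphM /= !rmorph_nat; ring.
rewrite big_split /= -!mulr_sumr !vA /a /= natrM; ring.
Qed.

(** The product of the two matrices acts by [k 0 * k 1 * x * y]. An entry is a sum of [N ^ 2] terms
    of size at most [2 ^ (2 N)], hence is at most [2 ^ (N ^ 2 + 2 N)]. *)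
Lemma small_eigM N x y :
  small_eig N x -> small_eig N y -> small_eig (N.+2 ^ 2) (x * y).
Proof.
move=> Sx Sy; pose a (i : 'I_2) := if i == 0 then x else y.
have Sa i : small_eig N (a i) by rewrite /a; case: ifP.
have [k [v [A [kN k0 AN v0 vA]]]] := common_eigenvector Sa.
apply: (@small_eig_fin _ v
  (fun s t => \sum_u A 0 s u * A 1 u t) (k 0%R * k 1%R)%N) => //.
- by rewrite card_ffun !card_ord; nia.
- apply: leq_trans (_ : 2 ^ (N + N) <= _)%N; last by rewrite leq_exp2l //; nia.
  by rewrite expnD leq_mul.
- by rewrite natrM mulf_neq0.
- move=> s t; apply: le_trans (ler_norm_sum _ _ _) _.
  apply: le_trans (_ : \sum_(u : {ffun 'I_2 -> 'I_N}) 2 ^+ (N + N) <= _).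
    by apply: ler_sum => u _; rewrite normrM exprD ler_pM.
  rewrite sumr_const card_ffun !card_ord -[leLHS]mulr_natl.
  apply: le_trans (_ : 2 ^+ (N ^ 2) * 2 ^+ (N + N) <= _).
    by rewrite ler_wpM2r ?exprn_ge0 // -[2]/(2%:R) -[leRHS]natrX ler_nat ltnW // ltn_expl.
  by rewrite -exprD ler_weXn2l ?ler1n //; nia.
move=> t; transitivity (\sum_s \sum_u v s * (A 0 s u)%:~R * (A 1 u t)%:~R).
  apply: eq_bigr => s _; rewrite rmorph_sum mulr_sumr.
  by apply: eq_bigr => u _; rewrite rmorphM /= mulrA.
rewrite exchange_big /=.
rewrite (eq_bigr (fun u => (k 0)%:R * x * (v u * (A 1 u t)%:~R))); last first.
  by move=> u _; rewrite -mulr_suml vA /a /=; ring.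
by rewrite -mulr_sumr vA /a /= natrM; ring.
Qed.


Lemma leq_mul_exp N c : (N * c <= N.+2 ^ c.+1)%N.
Proof.
rewrite expnS leq_mul //; first by rewrite -addn2 leq_addr.
by case: c => // c; apply: leq_trans (ltnW (ltn_expl _ (ltnSn 1))) _; rewrite leq_exp2r.
Qed.

(** Companion matrix of the monic polynomial [Y^d + \sum_i B_i Y^i] with matrix coefficients, acting
    on row vectors: column block [l] picks block [l + 1], and the last one carries the [- B_i]. The
    intended eigenvector is [(v, y v, ..., y^(d-1) v)]. *)
Definition block_companion (d : nat) (T : finType) (B : 'I_d -> T -> T -> int)
    (p q : 'I_d * T) : int :=
  if (q.1.+1 < d)%N then ((p.1 == q.1.+1 :> nat) && (p.2 == q.2))%:R
  else - B p.1 p.2 q.2.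

Lemma block_companion_le d (T : finType) (B : 'I_d -> T -> T -> int) m p q :
  1 <= m -> (forall i s t, `|B i s t| <= m) -> `|block_companion B p q| <= m.
Proof.
move=> m1 Bm; rewrite /block_companion; case: ifP => _; last by rewrite normrN.
by case: (_ && _); rewrite ?normr1 ?normr0 // (le_trans ler01).
Qed.

Lemma block_companionE d (T : finType) (B : 'I_d -> T -> T -> int)
    (b : 'I_d -> F) (v : T -> F) (y : F) :
  (forall i t, \sum_s v s * (B i s t)%:~R = b i * v t) ->
  y ^+ d + \sum_(i < d) b i * y ^+ i = 0 ->
  forall q : 'I_d * T,
    \sum_(p : 'I_d * T) y ^+ p.1 * v p.2 * (block_companion B p q)%:~R =
    y * (y ^+ q.1 * v q.2).
Proof.
move=> vB y0 [l t]; rewrite /block_companion /=; have [ld|ld] := ltnP l.+1 d.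
  rewrite (bigD1 (Ordinal ld, t)) //= !eqxx mulr1 big1 ?addr0; last first.
    case=> i s /= ne; suff -> : (i == l.+1 :> nat) && (s == t) = false.
      by rewrite mulr0.
    apply: contraNF ne => /andP[/eqP il /eqP ->].
    by apply/eqP; congr (_, _); apply: val_inj.
  by rewrite exprS mulrA.
have ldE : d = l.+1 by apply/eqP; rewrite eqn_leq ltn_ord andbT.
rewrite -(pair_bigA _ (fun (i : 'I_d) s => y ^+ i * v s * (- B i s t)%:~R)) /=.
transitivity (- (\sum_(i < d) b i * y ^+ i) * v t); last first.
  move/eqP: y0; rewrite addr_eq0 => /eqP <-.
  by rewrite [in LHS]ldE exprS mulrA.
rewrite -sumrN mulr_suml; apply: eq_bigr => i _.
rewrite (eq_bigr (fun s => - y ^+ i * (v s * (B i s t)%:~R))); last first.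
  by move=> s _; rewrite rmorphN /=; ring.
by rewrite -mulr_sumr vB; ring.
Qed.

(** Clear denominators: with [K] the product of the [k i], [y = K x] is a root of the monic
    polynomial with coefficients [K^(d - i) * a i], and these are eigenvalues of integer multiples
    of the [A i]. The block companion matrix then has eigenvalue [K x]. *)
Lemma small_eig_root N d (a : 'I_d -> F) x : (0 < d)%N ->
  (forall i, small_eig N (a i)) -> x ^+ d + \sum_(i < d) a i * x ^+ i = 0 ->
  small_eig (N.+2 ^ (d * d + d).+2) x.
Proof.
move=> d_gt0 Sa x0.
have [k [v [A [kN k0 AN [t0 vt0] vA]]]] := common_eigenvector Sa.
pose K := (\prod_i k i)%N.
have K0 : K%:R != 0 :> F by rewrite natr_prod; apply/prodf_neq0 => i _.
have KN : (K <= 2 ^ (N * d))%N.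
  rewrite expnM -[X in (_ <= _ ^ X)%N](card_ord d) -prod_nat_const.
  exact: leq_prod.
(* Chosen so that [c i * k i = K ^ (d - i)]: since [i < d], one factor [K] is available to give up
   its [k i]. *)
pose c (i : 'I_d) := (K ^ (d - i.+1) * \prod_(j | j != i) k j)%N.
have cE i : (c i * k i = K ^ (d - i))%N.
  have KE : K = (k i * \prod_(j | j != i) k j)%N by rewrite /K (bigD1 i).
  by rewrite /c -mulnA [(_ * k i)%N]mulnC -KE -expnSr subnSK.
have k_gt0 i : (0 < k i)%N by rewrite lt0n; apply: contraNneq (k0 i) => ->.
have K_gt0 : (0 < K)%N by apply: prodn_gt0.
have cN i : (c i <= 2 ^ (N * (d * d)))%N.
  apply: leq_trans (leq_pmulr _ (k_gt0 i)) _; rewrite cE mulnA expnM.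
  apply: leq_trans (_ : K ^ d <= _)%N; first by rewrite leq_pexp2l // leq_subr.
  by rewrite leq_exp2r.
set E := (N.+2 ^ _)%N.
have leE : (N * (d * d) + N <= E)%N.
  rewrite -mulnSr; apply: leq_trans (leq_mul_exp _ _) _.
  by rewrite leq_exp2l // !ltnS leq_addr.
have leE1 : (N * d <= E)%N.
  apply: leq_trans leE; rewrite mulnA; apply: leq_trans (leq_addr _ _).
  by rewrite leq_pmulr.
have leE2 : (d * N ^ d <= E)%N.
  apply: leq_trans (_ : N.+2 ^ d * N.+2 ^ d <= _)%N.
    rewrite leq_mul ?leq_exp2r //; last by rewrite -addn2 leq_addr.
    by apply: leq_trans (ltnW (ltn_expl d (ltnSn 1))) _; rewrite leq_exp2r.
  rewrite -expnD leq_exp2l //; nia.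
pose y := K%:R * x.
pose B i s t : int := (c i)%:R * A i s t.
have BE : forall i t, \sum_s v s * (B i s t)%:~R = K%:R ^+ (d - i) * a i * v t.
  move=> i t; rewrite (eq_bigr (fun s => (c i)%:R * (v s * (A i s t)%:~R))).
    by rewrite -mulr_sumr vA -natrX -cE natrM; ring.
  by move=> s _; rewrite rmorphM /= rmorph_nat; ring.
have y0 : y ^+ d + \sum_(i < d) K%:R ^+ (d - i) * a i * y ^+ i = 0.
  transitivity (K%:R ^+ d * (x ^+ d + \sum_(i < d) a i * x ^+ i)).
    rewrite mulrDr mulr_sumr exprMn; congr (_ + _); apply: eq_bigr => i _.
    have -> : K%:R ^+ d = K%:R ^+ (d - i) * K%:R ^+ i :> F.
      by rewrite -exprD subnK // ltnW.
    by rewrite exprMn; ring.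
  by rewrite x0 mulr0.
have eqB := block_companionE BE y0.
apply: (small_eig_fin (v := fun p : 'I_d * {ffun 'I_d -> 'I_N} => y ^+ p.1 * v p.2)
   (A := block_companion B) (k := K)) => //.
- by rewrite card_prod card_ffun !card_ord.
- by apply: leq_trans KN _; rewrite leq_exp2l.
- move=> p q; apply: block_companion_le => [|i s t]; first by rewrite exprn_ege1.
  rewrite normrM normr_nat.
  apply: le_trans (_ : 2 ^+ (N * (d * d) + N) <= _); last by rewrite ler_weXn2l ?ler1n.
  by rewrite exprD ler_pM // -natrX ler_nat.
- by exists (Ordinal d_gt0, t0); rewrite /= expr0 mul1r.
Qed.


(** * Coefficients of characteristic polynomials, and inverses *)

Definition coef_le (p P : {poly int}) := forall i, `|p`_i| <= P`_i.

Lemma coef_leM p q P Q : coef_le p P -> coef_le q Q -> coef_le (p * q) (P * Q).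
Proof.
move=> pP qQ i; rewrite !coefM; apply: le_trans (ler_norm_sum _ _ _) _.
by apply: ler_sum => j _; rewrite normrM ler_pM.
Qed.

Lemma coef_leD p q P Q : coef_le p P -> coef_le q Q -> coef_le (p + q) (P + Q).
Proof.
by move=> pP qQ i; rewrite !coefD; apply: le_trans (ler_normD _ _) _; rewrite lerD.
Qed.

(** Domination of coefficients is compatible with sums and products, and each of the [n!] terms of
    the Leibniz expansion is dominated by [('X + m)^n]. *)
Lemma coef_le_char_poly n (M : 'M[int]_n) (m : int) : 0 <= m ->
  (forall i j, `|M i j| <= m) ->
  coef_le (char_poly M) (('X + m%:P) ^+ n *+ n`!).
Proof.
move=> m0 Mm; rewrite /char_poly /determinant.
have -> : ('X + m%:P) ^+ n *+ n`! =
    \sum_(s : 'S_n) 1 * \prod_(i < n) ('X + m%:P) :> {poly int}.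
  by rewrite sumr_const card_Sn mul1r prodr_const card_ord.
elim/big_ind2: _ => [i|p P q Q pP qQ|s _].
- by rewrite coef0 normr0.
- exact: coef_leD.
apply: coef_leM => [i|].
  by case: (odd_perm s); rewrite ?expr0 ?expr1 ?coefN !coef1; case: (i == 0)%N;
     rewrite ?normrN ?normr1 ?normr0.
elim/big_ind2: _ => [i|p P q Q pP qQ|j _ i].
- by rewrite coef1; case: (i == 0)%N; rewrite ?normr1 ?normr0.
- exact: coef_leM.
rewrite !mxE !coefD coefN coefC coefC coefMn coefX.
apply: le_trans (ler_normD _ _) _; rewrite normrN lerD //.
  by case: (i == 1)%N; case: (j == s j) => //=; rewrite ?normr1 ?normr0 ?mulr0n.
by case: (i == 0)%N; rewrite ?normr0.
Qed.

(** The dominating polynomial has nonnegative coefficients, so each of them is at most its value at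
    1. *)
Lemma char_poly_coef_le n (M : 'M[int]_n) (m : int) : 0 <= m ->
  (forall i j, `|M i j| <= m) ->
  forall i, `|(char_poly M)`_i| <= (1 + m) ^+ n *+ n`!.
Proof.
move=> m0 Mm i; pose P : {poly int} := ('X + m%:P) ^+ n *+ n`!.
have cP : coef_le (char_poly M) P by apply: coef_le_char_poly.
have -> : (1 + m) ^+ n *+ n`! = P.[1].
  by rewrite /P hornerMn horner_exp hornerD hornerX hornerC.
apply: le_trans (cP i) _; rewrite horner_coef.
have [iP|iP] := ltnP i (size P).
  rewrite (bigD1 (Ordinal iP)) //= expr1n mulr1 lerDl sumr_ge0 // => j _.
  by rewrite expr1n mulr1; apply: le_trans (cP j).
rewrite nth_default // sumr_ge0 // => j _.
by rewrite expr1n mulr1; apply: le_trans (cP j).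
Qed.


Lemma fact_le_exp n : (n`! <= 2 ^ (n * n))%N.
Proof.
elim: n => // n IHn; rewrite factS.
apply: leq_trans (leq_mul (ltnW (ltn_expl n.+1 (ltnSn 1))) IHn) _.
by rewrite -expnD leq_exp2l //; nia.
Qed.

Lemma small_char_poly N n (M : 'M[int]_n) : (n <= N)%N ->
  (forall i j, `|M i j| <= 2 ^+ N) ->
  forall i, `|(char_poly M)`_i| <= 2 ^+ (N.+1 * N + N * N).
Proof.
move=> nN MN i; have m0 : 0 <= 2 ^+ N :> int by rewrite exprn_ge0.
apply: le_trans (char_poly_coef_le m0 MN i) _.
rewrite -[leLHS]mulr_natr exprD ler_pM //.
- by rewrite exprn_ge0 // addr_ge0.
- apply: le_trans (_ : (2 ^+ N.+1) ^+ n <= _); last first.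
    by rewrite exprM ler_weXn2l // exprn_ege1.
  rewrite lerXn2r ?nnegrE ?addr_ge0 ?exprn_ge0 //.
  have : 1 <= 2 ^+ N :> int by rewrite exprn_ege1.
  by rewrite [2 ^+ N.+1]exprS; lra.
- rewrite -natrX ler_nat; apply: leq_trans (fact_le_exp n) _.
  by rewrite leq_exp2l // leq_mul.
Qed.

(** Multiply the equation by [C 0 ^ r / y ^ (r + 1)] and put [w = C 0 / y]: the constant term
    becomes [w ^ (r + 1)], and the term of index [l > 0] becomes
    [C l * C 0 ^ (l - 1) * w ^ (r + 1 - l)]. *)
Lemma reversed_root r (C : nat -> F) y : y != 0 ->
  \sum_(l < r.+2) C l * y ^+ l = 0 ->
  (C 0%N / y) ^+ r.+1 +
    \sum_(i < r.+1) C (rev_ord i).+1 * C 0%N ^+ rev_ord i * (C 0%N / y) ^+ i = 0.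
Proof.
move=> y0; rewrite big_ord_recl /= expr0 mulr1.
rewrite (reindex_inj rev_ord_inj) /= => Cy.
transitivity (C 0%N ^+ r * y ^- r.+1 * 0); last by rewrite mulr0.
rewrite -[in RHS]Cy mulrDr mulr_sumr.
congr (_ + _); first by rewrite expr_div_n exprSr mulrAC.
apply: eq_bigr => i _; rewrite /bump leq0n add1n /=.
have lei : (i <= r)%N by rewrite -ltnS.
have -> : C 0%N ^+ r = C 0%N ^+ (r.+1 - i.+1) * C 0%N ^+ i.
  by rewrite -exprD subSS subnK.
have -> : y ^- r.+1 = y ^- (r.+1 - i.+1).+1 * y ^- i.
  by rewrite -invfM -exprD subSS addSn subnK.
rewrite expr_div_n; field.
by rewrite !expf_neq0.
Qed.

(* Invert the characteristic equation of [k x]: if [c] is its lowest coefficient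
   that does not vanish in [F], then [c / (k x)] is a root of a monic polynomial
   with small integer coefficients. *)
Lemma small_eigV N x : small_eig N x -> x != 0 -> small_eig (N.+2 ^ 4) x^-1.
Proof.
move=> [n [k [M [nN kN k0 MN]]]] eigM x0.
have n_gt0 : (0 < n)%N.
  case: n M eigM {nN MN} => // M /eigenvalueP[v _ /negP[]].
  by apply/eqP/rowP => -[].
pose chi := char_poly M; pose y := k%:R * x.
have y0 : y != 0 by rewrite mulf_neq0.
have sz_chi : size chi = n.+1 by rewrite size_char_poly.
pose C (i : nat) : F := (chi`_i)%:~R.
have Cn : C n = 1.
  by rewrite /C -[n]/(n.+1.-1) -sz_chi -lead_coefE (monicP (char_poly_monic M)).
have Cy : \sum_(i < n.+1) C i * y ^+ i = 0.
  have : root (char_poly (map_mx intr M : 'M[F]_n)) y by rewrite -eigenvalue_root_char.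
  rewrite -map_char_poly => /rootP; rewrite horner_coef size_map_poly_id0; last first.
    by rewrite (monicP (char_poly_monic M)) oner_eq0.
  by rewrite sz_chi => H; rewrite -[RHS]H; apply: eq_bigr => i _; rewrite coef_map.
have exC : exists j, C j != 0 by exists n; rewrite Cn oner_eq0.
have [j Cj minj] := ex_minnP exC.
have C_small i : (i < j)%N -> C i = 0.
  by move=> ij; apply/eqP; apply: contraTT ij => /minj; rewrite -leqNgt.
have le_jn : (j <= n)%N by apply: minj; rewrite Cn oner_eq0.
have {}Cy : \sum_(l < (n - j).+1) C (j + l)%N * y ^+ l = 0.
  apply: (mulfI (expf_neq0 j y0)); rewrite mulr0 -[RHS]Cy mulr_sumr; apply: esym.
  rewrite -(big_mkord xpredT (fun i => C i * y ^+ i)).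
  rewrite (big_cat_nat (n := j)) //=; last exact: leqW.
  rewrite big_nat_cond big1 ?add0r; last first.
    by move=> i /andP[/andP[_ ij] _]; rewrite C_small // mul0r.
  rewrite -{1}[j]add0n big_addn big_mkord subSn //.
  by apply: eq_bigr => l _; rewrite exprD addnC; ring.
have [r rE] : exists r, (n - j = r.+1)%N.
  case: (n - j)%N Cy => [|r _]; last by exists r.
  by rewrite big_ord1 addn0 expr0 mulr1 => Cj0; rewrite Cj0 eqxx in Cj.
rewrite rE in Cy.
have := reversed_root (C := fun l => C (j + l)%N) y0 Cy; rewrite addn0.
set w := C j / y => w0.
set b := (N.+1 * N + N * N)%N.
have chi_le i : `|chi`_i| <= 2 ^+ b by apply: small_char_poly.
have rN : (r.+1 <= N)%N by rewrite -rE; apply: leq_trans nN; rewrite leq_subr.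
pose B (i : 'I_r.+1) (_ _ : unit) := chi`_(j + (rev_ord i).+1) * chi`_j ^+ rev_ord i.
have BE (i : 'I_r.+1) (t : unit) :
    \sum_s (fun=> 1) s * (B i s t)%:~R =
    C (j + (rev_ord i).+1)%N * C j ^+ rev_ord i * (fun=> 1) t :> F.
  by rewrite (bigD1 tt) //= big1 => [|[]//]; rewrite addr0 mul1r mulr1 rmorphM rmorphXn.
have eqB := block_companionE BE w0.
have B_le i s t : `|B i s t| <= 2 ^+ (b * N).
  rewrite normrM normrX; apply: le_trans (_ : (2 ^+ b) ^+ (rev_ord i).+1 <= _).
    by rewrite exprS ler_pM ?exprn_ge0 // lerXn2r ?nnegrE ?exprn_ge0.
  rewrite exprM ler_weXn2l ?exprn_ege1 //.
  by apply: leq_trans rN; rewrite ltn_ord.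
have bE : (N + b * N <= N.+2 ^ 4)%N.
  by rewrite /b !expnS expn0; nia.
(* The denominator must be a natural number, hence the absolute value of the coefficient of index
   [j]. Since [w = C j / (k x)], that absolute value times [x^-1] equals [sg * k * w]. *)
pose sg : int := Num.sg chi`_j.
apply: (small_eig_fin (v := fun p : 'I_r.+1 * unit => w ^+ p.1 * 1)
   (A := fun p q => sg * k%:R * block_companion B p q) (k := absz chi`_j)).
- rewrite card_prod card_ord card_unit muln1; apply: leq_trans rN _.
  by apply: leq_trans bE; rewrite leq_addr.
- rewrite -(ler_nat int) natrX natz abszE; apply: le_trans (chi_le j) _.
  rewrite ler_weXn2l ?ler1n //; apply: leq_trans bE.
  by apply: leq_trans (leq_addl _ _); rewrite leq_pmulr // (leq_trans _ rN).
- have -> : (absz chi`_j)%:R = (sg * chi`_j)%:~R :> F.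
    by rewrite -[LHS]/((Posz _)%:~R) abszE normrEsg.
  rewrite rmorphM mulf_neq0 //= /sg; case: sgrP Cj => [/eqP|_ _|_ _].
  + by rewrite /C => /eqP ->; rewrite eqxx.
  + by rewrite oner_eq0.
  + by rewrite rmorphN1 oppr_eq0 oner_eq0.
- move=> p q; rewrite !normrM normr_nat.
  apply: le_trans (_ : 2 ^+ (N + b * N) <= _); last by rewrite ler_weXn2l ?ler1n.
  rewrite exprD ler_pM ?mulr_ge0 //.
    rewrite -[leRHS]mul1r ler_pM //; last by rewrite -natrX ler_nat.
    by rewrite normr_sg; case: (_ != _).
  by apply: block_companion_le => //; rewrite exprn_ege1.
- by exists (ord0, tt); rewrite /= expr0 mul1r oner_eq0.
move=> q; rewrite (eq_bigr (fun p : 'I_r.+1 * unit =>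
  (sg * k%:R)%:~R * (w ^+ p.1 * 1 * (block_companion B p q)%:~R))); last first.
  by move=> p _; rewrite [in LHS]rmorphM /=; ring.
rewrite -mulr_sumr eqB [LHS]mulrA; congr (_ * _).
have -> : (absz chi`_j)%:R = (sg * chi`_j)%:~R :> F.
  by rewrite -[LHS]/((Posz _)%:~R) abszE normrEsg.
rewrite !rmorphM /= rmorph_nat /w -/(C j) /y; field.
by rewrite x0 k0.
Qed.

End SmallEig.

Local Open Scope classical_set_scope.
Local Open Scope ring_scope.

(** * Real closed subfields *)

Section RealClosedSubfield.
Variables (K : fieldType) (S : set K).
Hypothesis S1 : S 1.
Hypothesis SB : forall x y, S x -> S y -> S (x - y).
Hypothesis SV : forall x y, S x -> S y -> S (x / y).
Hypothesis noN1 : forall x : K, x ^+ 2 != -1.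
Hypothesis Ssqr : forall x, S x -> exists2 y, S y & x = y ^+ 2 \/ x = - y ^+ 2.
Hypothesis Ssum : forall x y, S x -> S y -> exists z, x ^+ 2 + y ^+ 2 = z ^+ 2.
Hypothesis Sodd : forall (d : nat) (a : 'I_d -> K), odd d -> (forall i, S (a i)) ->
  exists2 x, S x & x ^+ d + \sum_(i < d) a i * x ^+ i = 0.

Definition subfield_pred : {pred K} := fun x => `[< S x >].

Lemma subfield_divring_closed : divring_closed subfield_pred.
Proof.
split; first exact/asboolP.
- by move=> x y /asboolP Sx /asboolP Sy; apply/asboolP/SB.
- by move=> x y /asboolP Sx /asboolP Sy; apply/asboolP/SV.
Qed.

HB.instance Definition _ :=
  GRing.isDivringClosed.Build K subfield_pred subfield_divring_closed.

Record subfield_type :=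
  MkSubfield { subfield_val : K; _ : subfield_val \in subfield_pred }.
Local Notation T := subfield_type.

HB.instance Definition _ := [isSub for subfield_val].
HB.instance Definition _ := [Choice of T by <:].
HB.instance Definition _ := [SubChoice_isSubComUnitRing of T by <:].
HB.instance Definition _ := [SubComUnitRing_isSubIntegralDomain of T by <:].
HB.instance Definition _ := [SubIntegralDomain_isSubField of T by <:].

(** Here [z] ranges over all of [K], as in [Fle]; [sqle0P] brings the root into the subfield. *)
Definition sqle (x y : T) : bool := `[< exists z : K, val y - val x = z ^+ 2 >].

Lemma subfieldP (x : T) : S (val x).
Proof. by apply/asboolP; apply: (valP x). Qed.

Lemma sqr_opp_sqr (x y : K) : x ^+ 2 = - y ^+ 2 -> x = 0.
Proof.
move=> xy; have [y0|y0] := eqVneq y 0.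
  by apply/eqP; rewrite -sqrf_eq0 xy y0 expr0n oppr0.
case/eqP: (noN1 (x / y)).
by rewrite expr_div_n xy mulNr divff // expf_neq0.
Qed.

(** By [Ssqr], [x] is plus or minus the square of an element of [S]. If it is [- y^2] and also a
    square in [K], it vanishes because -1 is not a square. *)
Lemma sqle0P (x : T) : reflect (exists y : T, x = y ^+ 2) (sqle 0 x).
Proof.
apply: (iffP idP) => [/asboolP[z]|[y ->]]; last first.
  by apply/asboolP; exists (val y); rewrite !rmorphE subr0.
rewrite rmorph0 subr0 => xz.
have [y Sy xy] := Ssqr (subfieldP x).
have Ty : y \in subfield_pred by apply/asboolP.
exists (MkSubfield Ty); apply: val_inj; rewrite rmorphXn /=.
case: xy => // xy; have z0 : z = 0 by apply: (@sqr_opp_sqr z y); rewrite -xz.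
have y20 : y ^+ 2 = 0 by rewrite -[LHS]opprK -xy xz z0 expr0n oppr0.
by rewrite y20 [LHS]xz z0 expr0n.
Qed.

Lemma sqle_sub (x y : T) : sqle 0 (y - x) = sqle x y.
Proof. by rewrite /sqle rmorph0 subr0 rmorphB. Qed.

Lemma sqle0_total (x : T) : sqle 0 x || sqle x 0.
Proof.
have [y Sy xy] := Ssqr (subfieldP x).
case: xy => xy; apply/orP; [left|right]; apply/asboolP; exists y.
  by rewrite rmorph0 subr0.
by rewrite rmorph0 sub0r xy opprK.
Qed.

Lemma sqle0_anti (x : T) : sqle 0 x -> sqle x 0 -> x = 0.
Proof.
move=> /asboolP[y]; rewrite rmorph0 subr0 => xy /asboolP[z].
rewrite rmorph0 sub0r xy => yz; apply: val_inj; rewrite rmorph0 xy.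
have y0 : y = 0 by apply: (@sqr_opp_sqr y z); rewrite -yz opprK.
by rewrite y0 expr0n.
Qed.

Lemma sqle0_add (x y : T) : sqle 0 x -> sqle 0 y -> sqle 0 (x + y).
Proof.
move=> /sqle0P[u ->] /sqle0P[v ->].
have [z uvz] := Ssum (subfieldP u) (subfieldP v).
by apply/asboolP; exists z; rewrite rmorph0 subr0 -uvz !rmorphE.
Qed.

Lemma sqle0_mul (x y : T) : sqle 0 x -> sqle 0 y -> sqle 0 (x * y).
Proof.
by move=> /sqle0P[u ->] /sqle0P[v ->]; apply/sqle0P; exists (u * v); rewrite exprMn.
Qed.

Definition sqnorm (x : T) : T := if sqle 0 x then x else - x.

Lemma sqnormN (x : T) : sqnorm (- x) = sqnorm x.
Proof.
have leN : sqle 0 (- x) = sqle x 0 by rewrite -sub0r sqle_sub.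
rewrite /sqnorm leN opprK; have := sqle0_total x; have := @sqle0_anti x.
case: (sqle 0 x); case: (sqle x 0) => //= anti _.
by rewrite anti // oppr0.
Qed.

Lemma ge0_sqnorm (x : T) : sqle 0 x -> sqnorm x = x.
Proof. by rewrite /sqnorm => ->. Qed.

HB.instance Definition _ := Num.IntegralDomain_isLeReal.Build T
  sqle0_add sqle0_mul sqle0_anti sqle_sub sqle0_total sqnormN ge0_sqnorm
  (fun x y => erefl ((y != x) && sqle x y)).

Lemma subfield_sqrt (x : T) : 0 <= x -> exists y : T, y ^+ 2 = x.
Proof. by move=> /sqle0P[y ->]; exists y. Qed.

Lemma subfield_odd_root (p : {poly T}) :
  p \is monic -> ~~ odd (size p) -> exists x, root p x.
Proof.
move=> mon_p; have p0 := monic_neq0 mon_p.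
have szp : size p = (size p).-1.+1 by rewrite prednK // size_poly_gt0.
rewrite szp /= negbK => oddp.
have [i|x Sx x0] := Sodd (a := fun i : 'I_(size p).-1 => val p`_i) oddp.
  exact: subfieldP.
have Tx : x \in subfield_pred by apply/asboolP.
pose t := MkSubfield Tx; exists t; apply/eqP/val_inj.
have -> : p.[t] = t ^+ (size p).-1 + \sum_(i < (size p).-1) p`_i * t ^+ i.
  rewrite horner_coef szp big_ord_recr /= -lead_coefE (monicP mon_p) mul1r.
  exact: addrC.
rewrite rmorphD rmorphXn rmorph_sum rmorph0 -[RHS]x0; congr (_ + _).
by apply: eq_bigr => i _; rewrite rmorphM rmorphXn.
Qed.

HB.instance Definition _ := Num.RealField_isClosed.Build T
  (odd_sqrt_real_closed subfield_sqrt subfield_odd_root).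

Theorem real_closed_subfield :
  is_real_closed_field S (fun a b => exists x, b - a = x ^+ 2).
Proof.
exists (T : rcfType), (val : {rmorphism T -> K}); split.
  apply/seteqP; split=> [_ [x _ <-]|x Sx]; first exact: subfieldP.
  have Tx : x \in subfield_pred by apply/asboolP.
  by exists (MkSubfield Tx).
by move=> x y; split=> [/asboolP|?]; [|apply/asboolP].
Qed.
End RealClosedSubfield.

(** * The internal complexity function *)

Section InternalEigenvalue.
Local Open Scope nat_scope.

(** The condition minimised in [fQbar], at one ordinary modulus [q]; [fQbarE] assembles [fQbar] from
    the resulting functions [fq]. *)
Definition eig_witness (q x v : nat) : Prop :=
  exists n m k (M : nat -> nat -> nat),
    [/\ 1 <= n /\ k %% q <> 0,
        forall a b, a < n -> b < n -> M a b < q,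
        forall a b, a < n -> b < n -> minn (M a b) (q - M a b) <= m,
        eigenvalue_mod q n M ((k * x) %% q)
      & v = n + up_log 2 (maxn m k)].

Definition fq (q x : nat) : nat :=
  xget 0 [set v | eig_witness q x v /\ forall v', eig_witness q x v' -> v <= v'].

Lemma nat_least (P : nat -> Prop) : (exists n, P n) ->
  exists n, P n /\ forall m, P m -> n <= m.
Proof.
move=> [n Pn]; have exP : exists n, `[< P n >] by exists n; apply/asboolP.
case: (ex_minnP exP) => m /asboolP Pm minm; exists m; split=> // k Pk.
by apply: minm; apply/asboolP.
Qed.

(** The 1 x 1 matrix with entry [x %% q] serves, so for prime [q] the value of [fq] is a true
    minimum and not the default 0. *)
Lemma eig_witness_ex q x : prime q -> exists v, eig_witness q x v.
Proof.
move=> pr_q; have q_gt0 := prime_gt0 pr_q; have q_gt1 := prime_gt1 pr_q.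
exists (1 + up_log 2 (maxn q 1)), 1, q, 1, (fun _ _ => x %% q); split=> //.
- by rewrite modn_small.
- by move=> a b _ _; rewrite ltn_mod.
- by move=> a b _ _; rewrite geq_min ltnW // ltn_mod.
apply/eigenvalueP; exists (const_mx 1%R); last first.
  by apply/eqP => /rowP/(_ ord0); rewrite !mxE => /eqP; rewrite oner_eq0.
by apply/rowP => j; rewrite !mxE big_ord1 !mxE mul1r mulr1 mul1n.
Qed.

Lemma fqP q x : prime q ->
  eig_witness q x (fq q x) /\ forall v, eig_witness q x v -> fq q x <= v.
Proof.
move=> pr_q; have [v vP] := nat_least (eig_witness_ex x pr_q).
exact: (xgetPex 0 (ex_intro
  [set v | eig_witness q x v /\ forall v', eig_witness q x v' -> v <= v'] v vP)).
Qed.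

Section Transfer.
Variables (I : Type) (F : set_system I) (FU : UltraFilter F).
Local Notation hnat := (hnat FU).

Lemma ae_imp (A B : set I) : (F A -> F B) -> F [set i | A i -> B i].
Proof.
move=> AB; have [/AB|nA] := in_ultra_setVsetC A FU; first by apply: filterS => i Bi _.
by apply: filterS nA => i nAi /nAi.
Qed.

(** The universal step of Los's theorem: apply the hypothesis to a sequence that picks a
    counterexample wherever there is one. *)
Lemma ae_forall (T : pointedType) (P : I -> T -> Prop) :
  (forall a : I -> T, F [set i | P i (a i)]) -> F [set i | forall a, P i a].
Proof.
move=> H; have /choice[a aP] : forall i, exists a, P i a -> forall b, P i b.
  move=> i; have [Pi|/existsNP[b nPb]] := pselect (forall b, P i b).
    by exists point.
  by exists b => Pb; case: nPb.
by apply: filterS (H a) => i /aP.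
Qed.

Lemma hleE (u v : I -> nat) : hle (ucls FU u) (ucls FU v) <-> F [set i | u i <= v i].
Proof. by rewrite /hle /star !uappE uholdsE; split=> /asboolP. Qed.

Lemma hltE2 (u v : I -> nat) : hlt (ucls FU u) (ucls FU v) <-> F [set i | u i < v i].
Proof. by rewrite /hlt /star !uappE uholdsE; split=> /asboolP. Qed.

Lemma hle_trans (x y z : hnat) : hle x y -> hle y z -> hle x z.
Proof.
rewrite -(urepK x) -(urepK y) -(urepK z) => /hleE xy /hleE yz; apply/hleE.
by apply: filterS2 xy yz => i /=; apply: leq_trans.
Qed.

Lemma hle_anti (x y : hnat) : hle x y -> hle y x -> x = y.
Proof.
rewrite -(urepK x) -(urepK y) => /hleE xy /hleE yx; apply/ucls_eq.
by apply: filterS2 xy yx => i /= xy yx; apply/eqP; rewrite eqn_leq xy.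
Qed.

Lemma hltNge (x y : hnat) : hlt x y <-> ~ hle y x.
Proof.
rewrite -(urepK x) -(urepK y); split=> [/hltE2 xy /hleE yx|nyx].
  apply: (@filter_not_empty _ F); apply: filterS2 xy yx => i /=.
  by rewrite ltnNge => /negP.
have [yx|] := in_ultra_setVsetC [set i | urep y i <= urep x i] FU.
  by case: nyx; apply/hleE.
by move=> xy; apply/hltE2; apply: filterS xy => i /= /negP; rewrite -ltnNge.
Qed.

Lemma hleastE (S : set hnat) (a : hnat) :
  S a -> (forall y, S y -> hle a y) -> hleast S = a.
Proof.
move=> Sa mina.
have [Sb minb] : [set x | S x /\ forall y, S y -> hle x y] (hleast S).
  by apply: xgetPex; exists a.
by apply: hle_anti; [apply: minb|apply: mina].
Qed.

Lemma hgreatestE (S : set hnat) (a : hnat) :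
  S a -> (forall y, S y -> hle y a) -> hgreatest S = a.
Proof.
move=> Sa maxa.
have [Sb maxb] : [set x | S x /\ forall y, S y -> hle y x] (hgreatest S).
  by apply: xgetPex; exists a.
by apply: hle_anti; [apply: maxa|apply: maxb].
Qed.

Variables (p : hnat) (p_prime : hprime p).
Local Notation K := (Fp p_prime).
Local Notation P i := (urep p i).
Local Notation inK u := (inFp p_prime (ucls FU u)).

Lemma inK_eq (u v : I -> nat) :
  inK u = inK v <-> F [set i | u i %% P i = v i %% P i].
Proof. by split; move/(inFp_eq p_prime u v). Qed.

Lemma inFp_neq0 (u : I -> nat) : inK u != 0%R <-> F [set i | u i %% P i <> 0].
Proof.
split=> [|H].
  have [u0|] := in_ultra_setVsetC [set i | u i %% P i = 0] FU.
    suff -> : inK u = 0%R by rewrite eqxx.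
    by apply/(inK_eq _ (fun=> 0)); apply: filterS u0 => i /= ->; rewrite mod0n.
  by move=> nz _; apply: filterS nz.
apply/eqP => u0.
have /inK_eq {}u0 : inK u = inK (fun=> 0) by exact: u0.
apply: (@filter_not_empty _ F); apply: filterS2 H u0 => i /=.
by rewrite mod0n.
Qed.

Lemma habsE (u : I -> nat) : habs p (ucls FU u) = ucls FU (fun i => minn (u i) (P i - u i)).
Proof. by rewrite -[p in LHS]urepK /habs /hmin /hsub /star !uappE. Qed.

Lemma hentryE (M : I -> nat -> nat -> nat) (a b : I -> nat) :
  hentry (ucls FU M) (ucls FU a) (ucls FU b) = ucls FU (fun i => M i (a i) (b i)).
Proof. by rewrite /hentry !uappE. Qed.

Lemma ae_internal (n : I -> nat) (Q : I -> nat -> nat -> Prop) :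
  (forall a b : I -> nat, F [set i | a i < n i] -> F [set i | b i < n i] ->
     F [set i | Q i (a i) (b i)]) <->
  F [set i | forall a b, a < n i -> b < n i -> Q i a b].
Proof.
split=> H.
  apply: (@ae_forall nat (fun i a => forall b, a < n i -> b < n i -> Q i a b)) => a.
  apply: (@ae_forall nat (fun i b => a i < n i -> b < n i -> Q i (a i) b)) => b.
  apply: (@ae_imp [set i | a i < n i] [set i | b i < n i -> Q i (a i) (b i)]) => an.
  by apply: (@ae_imp [set i | b i < n i] [set i | Q i (a i) (b i)]) => bn; apply: H.
by move=> a b an bn; apply: filterS3 H an bn => i /= H ? ?; apply: H.
Qed.

Lemma heigenvalueE (n : I -> nat) (M : I -> nat -> nat -> nat) (k u : I -> nat) :
  heigenvalue (ucls FU n) (ucls FU M) (inK k * inK u)%R <->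
  F [set i | eigenvalue_mod (P i) (n i) (M i) ((k i * u i) %% P i)].
Proof.
rewrite -[(_ * _)%R]/(Fmul _ _) FmulE /heigenvalue /= hmodE.
rewrite -[X in uapp (uapp (uapp (uapp _ X) _) _) _]urepK /star !uappE uholdsE.
by split=> /asboolP.
Qed.


(** By Los's theorem the set minimised in [fQbar] consists of the classes of sequences satisfying
    [eig_witness] almost everywhere, so its least element is the class of the pointwise minima. *)
Lemma fQbarE (u : I -> nat) : fQbar (inK u) = ucls FU (fun i => fq (P i) (u i)).
Proof.
have pr_ae := prime_ae p_prime.
have SE (w : I -> nat) : (exists n m k M,
    [/\ hle (star FU 1) n /\ inFp p_prime k != 0%R,
        internal_mx p n M,
        forall a b, hlt a n -> hlt b n -> hle (habs p (hentry M a b)) m,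
        heigenvalue n M (inFp p_prime k * inK u)%R &
        ucls FU w = hadd n (hceil_log2 (hmax m k))]) <->
    F [set i | eig_witness (P i) (u i) (w i)].
  split=> [[n [m [k [M]]]]|].
    rewrite -(urepK n) -(urepK m) -(urepK k) -(urepK M).
    move: (urep n) (urep m) (urep k) (urep M) => {}n {}m {}k {}M.
    move=> [[/hleE n1 /inFp_neq0 k0] intM absM /heigenvalueE eigM].
    rewrite /hadd /hceil_log2 /hmax /star !uappE => /ucls_eq wE.
    have {}intM : F [set i | forall a b, a < n i -> b < n i -> M i a b < P i].
      apply/(ae_internal n (fun i a b => M i a b < P i)) => a b an bn.
      by apply/hltE; rewrite -hentryE; apply: intM; apply/hltE2.
    have {}absM : F [set i | forall a b, a < n i -> b < n i ->
        minn (M i a b) (P i - M i a b) <= m i].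
      apply/(ae_internal n (fun i a b => minn (M i a b) (P i - M i a b) <= m i)).
      move=> a b an bn.
      by apply/hleE; rewrite -habsE -hentryE; apply: absM; apply/hltE2.
    apply: filterS2 (filterI (filterI n1 k0) (filterI intM absM)) (filterI eigM wE).
    by move=> i /= [[? ?] [? ?]] [? ?]; exists (n i), (m i), (k i), (M i).
  move=> wit.
  (* Witnesses are chosen pointwise, with defaults at the indices that have none; their classes are
     the internal witnesses. *)
  have /choice[n /choice[m /choice[k /choice[M H]]]] :
    forall i, exists n m k M, eig_witness (P i) (u i) (w i) ->
      [/\ 1 <= n /\ k %% P i <> 0,
        forall a b, a < n -> b < n -> M a b < P i,
        forall a b, a < n -> b < n -> minn (M a b) (P i - M a b) <= m,
        eigenvalue_mod (P i) n M ((k * u i) %% P i)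
      & w i = n + up_log 2 (maxn m k)].
    move=> i; have [[n [m [k [M H]]]]|nw] := pselect (eig_witness (P i) (u i) (w i)).
      by exists n, m, k, M.
    by exists 0, 0, 0, (fun _ _ => 0).
  have {wit} : F [set i | [/\ 1 <= n i /\ k i %% P i <> 0,
        forall a b, a < n i -> b < n i -> M i a b < P i,
        forall a b, a < n i -> b < n i -> minn (M i a b) (P i - M i a b) <= m i,
        eigenvalue_mod (P i) (n i) (M i) ((k i * u i) %% P i)
      & w i = n i + up_log 2 (maxn (m i) (k i))]].
    by apply: filterS wit => i /= /H.
  move=> {}H; exists (ucls FU n), (ucls FU m), (ucls FU k), (ucls FU M); split.
  - split; first by apply/hleE; apply: filterS H => i /= [[]].
    by apply/inFp_neq0; apply: filterS H => i /= [[]].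
  - move=> a b; rewrite -(urepK a) -(urepK b) => /hltE2 an /hltE2 bn.
    rewrite hentryE; apply/hltE; apply: filterS3 H an bn => i /= [_ intM _ _ _].
    exact: intM.
  - move=> a b; rewrite -(urepK a) -(urepK b) => /hltE2 an /hltE2 bn.
    rewrite hentryE habsE; apply/hleE; apply: filterS3 H an bn => i /= [_ _ absM _ _].
    exact: absM.
  - by apply/heigenvalueE; apply: filterS H => i /= [].
  - rewrite /hadd /hceil_log2 /hmax /star !uappE; apply/ucls_eq.
    by apply: filterS H => i /= [].
apply: hleastE.
  by apply/SE; apply: filterS pr_ae => i /= pr_i; have [] := fqP (u i) pr_i.
move=> y; rewrite -(urepK y) => /SE wit; apply/hleE.
apply: filterS2 pr_ae wit => i /= pr_i wit.
by have [_] := fqP (u i) pr_i; apply.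
Qed.

End Transfer.

End InternalEigenvalue.

(** * Residues of small absolute value and small integers *)

Lemma natrF_eq0 q k : prime q -> (k%:R == 0 :> 'F_q) = (k %% q == 0)%N.
Proof. by move=> pr_q; rewrite -(dvdn_pcharf (pchar_Fp pr_q)). Qed.

Lemma natrF_eq q a b : prime q -> (a%:R = b%:R :> 'F_q) <-> (a %% q = b %% q)%N.
Proof.
move=> pr_q; split=> [ab|ab]; last by rewrite -[LHS](Fp_nat_mod pr_q) ab Fp_nat_mod.
by rewrite -!(val_Fp_nat pr_q) ab.
Qed.

(** Each matrix entry is lifted to its integer representative of least absolute value. *)
Lemma fq_small_eig q x N : prime q -> (fq q x <= N)%N -> small_eig N (x%:R : 'F_q).
Proof.
move=> pr_q; have [[n [m [k [M [[n1 k0] Mq Mm eigM ->]]]]] _] := fqP x pr_q => leN.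
have mkN : (maxn m k <= 2 ^ N)%N.
  apply: leq_trans (up_logP _ (ltnSn 1)) _; rewrite leq_exp2l //.
  by apply: leq_trans leN; rewrite leq_addl.
pose z (a : nat) : int := if (a <= q - a)%N then a%:Z else a%:Z - q%:Z.
have zE a : (z a)%:~R = a%:R :> 'F_q.
  rewrite /z; case: ifP => // _; rewrite rmorphB /=.
  by rewrite -[(q%:Z)%:~R]/(q%:R : 'F_q) (pcharf0 (pchar_Fp pr_q)) subr0.
exists n, k, (\matrix_(i, j) z (M i j)); split.
- by apply: leq_trans leN; rewrite leq_addr.
- by apply: leq_trans mkN; rewrite leq_maxr.
- by rewrite natrF_eq0 //; apply/eqP.
- move=> i j; rewrite mxE; have := Mm i j (ltn_ord i) (ltn_ord j).
  have := Mq i j (ltn_ord i) (ltn_ord j); move: (M i j) => a aq am.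
  have {}am : (minn a (q - a) <= 2 ^ N)%N.
    by apply: leq_trans am _; apply: leq_trans mkN; rewrite leq_maxl.
  rewrite -[2]/(2%:R) -natrX natz /z; case: ifP => ifa; lia.
- rewrite -natrM -(Fp_nat_mod pr_q); move: eigM; rewrite /eigenvalue_mod.
  suff -> : \matrix_(i < n, j < n) (M i j)%:R =
            map_mx intr (\matrix_(i, j) z (M i j)) :> 'M['F_q]_n.
    by [].
  by apply/matrixP => i j; rewrite !mxE zE.
Qed.

(** Reduction modulo [q] does not increase absolute values; the size and the logarithm contribute at
    most [N] each. *)
Lemma small_eig_fq q x N : prime q -> small_eig N (x%:R : 'F_q) -> (fq q x <= N + N)%N.
Proof.
move=> pr_q [n [k [M [nN kN k0 MN eigM]]]].
have q_gt0 := prime_gt0 pr_q; have [_ minf] := fqP x pr_q.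
have n_gt0 : (0 < n)%N.
  case: n M eigM {nN MN} => // M /eigenvalueP[v _ /negP[]].
  by apply/eqP/rowP => -[].
pose M' a b : nat := if (insub a, insub b) is (Some i, Some j)
  then absz (M i j %% q)%Z else 0%N.
have M'E (i j : 'I_n) : M' i j = absz (M i j %% q)%Z by rewrite /M' !valK.
have absE (z : int) : (absz (z %% q)%Z)%:Z = (z %% q)%Z by lia.
apply: leq_trans (minf (n + up_log 2 (maxn (2 ^ N) k))%N _) _; last first.
  by rewrite leq_add // up_log_min // geq_max leqnn.
exists n, (2 ^ N)%N, k, M'; split; last exact: erefl.
- split; last by apply/eqP; rewrite -natrF_eq0.
  exact: n_gt0.
- by move=> a b an bn; rewrite (M'E (Ordinal an) (Ordinal bn)); lia.
- move=> a b an bn; rewrite (M'E (Ordinal an) (Ordinal bn)).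
  have := MN (Ordinal an) (Ordinal bn); move: (M _ _) => z.
  rewrite -[2]/(2%:R) -natrX natz => zN.
  have [z0|z0] := leP 0 z.
    rewrite geq_min; apply/orP; left.
    apply: leq_trans (_ : absz z <= _)%N; last lia.
    have -> : z = (absz z)%:Z by lia.
    by rewrite modz_nat absz_nat leq_mod.
  rewrite geq_min; have [->//|r0] := eqVneq (absz (z %% q)%Z) 0%N.
  apply/orP; right; apply: leq_trans (_ : absz z <= _)%N; last lia.
  have := divz_eq z q; have : (z %% q)%Z < q by lia.
  have : 0 < (z %% q)%Z by lia.
  move: (z %/ q)%Z (z %% q)%Z {r0} => d r r0 rq zE.
  (* With [z = d q + r < 0] the quotient is at most -1, so [q - r <= - d q - r = - z]. *)
  have d_lt0 : d < 0 by nia.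
  nia.
- rewrite /eigenvalue_mod (Fp_nat_mod pr_q) [(k * x)%:R]natrM.
  suff -> : \matrix_(i < n, j < n) (M' i j)%:R = map_mx intr M :> 'M['F_q]_n by [].
  apply/matrixP => i j; rewrite !mxE M'E -[LHS]/((Posz _)%:~R) absE.
  have -> : (M i j)%:~R = ((M i j %/ q)%Z * q + (M i j %% q)%Z)%:~R :> 'F_q.
    by rewrite -divz_eq.
  rewrite [RHS]intrD [X in X + _]intrM.
  by rewrite -[(q%:Z)%:~R]/(q%:R : 'F_q) (pcharf0 (pchar_Fp pr_q)) mulr0 add0r.
Qed.

(** * The field [Fp] as an ultraproduct of prime fields *)

Section Residues.
Variables (I : Type) (F : set_system I) (FU : UltraFilter F).
Variables (p : hnat FU) (p_prime : hprime p).
Local Notation K := (Fp p_prime).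
Local Notation P i := (urep p i).
Local Notation inK u := (inFp p_prime (ucls FU u)).

(** The component is read off a chosen representative, and ['F_(P i)] is the ring of residues modulo
    [P i] only when [P i] is prime; hence the compatibility with the operations is stated almost
    everywhere. *)
Definition res (x : K) (i : I) : 'F_(P i) := (urep (Fp_val x) i)%:R.

Lemma inFp_val (x : K) : inK (urep (Fp_val x)) = x.
Proof.
have [u xE up] := FpP x; rewrite {}xE; apply/inK_eq; rewrite /= hmodE.
by apply: filterS (urep_cls FU (fun i => u i %% P i)%N) => i /= ->; rewrite modn_mod.
Qed.

Lemma res_inK (u : I -> nat) : F [set i | res (inK u) i = (u i)%:R].
Proof.
rewrite /res /= hmodE.
apply: filterS2 (prime_ae p_prime) (urep_cls FU (fun i => u i %% P i)%N) => i /= pr_i ->.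
by rewrite (Fp_nat_mod pr_i).
Qed.

Lemma res_ex (f : forall i, 'F_(P i)) : exists x : K, F [set i | res x i = f i].
Proof.
pose u i : nat := val (f i).
exists (inK u); apply: filterS (res_inK u) => i /= ->; exact: natr_Zp.
Qed.

Lemma res_eq (x y : K) : x = y <-> F [set i | res x i = res y i].
Proof.
split=> [->|xy]; first by apply: filterS filterT => i _ /=.
rewrite -[x]inFp_val -[y]inFp_val; apply/inK_eq.
by apply: filterS2 (prime_ae p_prime) xy => i /= pr_i /(natrF_eq _ _ pr_i).
Qed.

Lemma resD (x y : K) : F [set i | res (x + y) i = res x i + res y i].
Proof.
rewrite -[X in res (X + _)]inFp_val -[X in res (_ + X)]inFp_val.
rewrite -[_ + _]/(Fadd _ _) FaddE.
by apply: filterS (res_inK (fun i => urep (Fp_val x) i + urep (Fp_val y) i)%N) => i /= ->;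
   rewrite natrD.
Qed.

Lemma resM (x y : K) : F [set i | res (x * y) i = res x i * res y i].
Proof.
rewrite -[X in res (X * _)]inFp_val -[X in res (_ * X)]inFp_val.
rewrite -[_ * _]/(Fmul _ _) FmulE.
by apply: filterS (res_inK (fun i => urep (Fp_val x) i * urep (Fp_val y) i)%N) => i /= ->;
   rewrite natrM.
Qed.

Lemma res_nat (n : nat) : F [set i | res n%:R i = n%:R].
Proof.
elim: n => [|n IHn]; first exact: (res_inK (fun=> 0%N)).
have res1 : F [set i | res 1 i = 1] by exact: (res_inK (fun=> 1%N)).
rewrite -natr1; apply: filterS3 (resD n%:R 1) IHn res1 => i /= -> -> ->.
by rewrite natr1.
Qed.

Lemma resN (x : K) : F [set i | res (- x) i = - res x i].
Proof.
apply: filterS2 (resD (- x) x) (res_nat 0) => i /=.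
by rewrite addNr => -> /eqP; rewrite addr_eq0 => /eqP.
Qed.

Lemma res_int (z : int) : F [set i | res z%:~R i = z%:~R].
Proof.
case: z => n; first exact: res_nat.
rewrite NegzE; apply: filterS2 (resN n.+1%:R) (res_nat n.+1) => i /=.
by rewrite !mulrNz -!pmulrn => -> ->.
Qed.

Lemma resX (x : K) n : F [set i | res (x ^+ n) i = res x i ^+ n].
Proof.
elim: n => [|n IHn].
  by rewrite expr0; apply: filterS (res_nat 1) => i /= ->; rewrite expr0.
rewrite exprS; apply: filterS2 (resM x (x ^+ n)) IHn => i /= -> ->.
by rewrite exprS.
Qed.

Lemma res_sum d (a : 'I_d -> K) :
  F [set i | res (\sum_(j < d) a j) i = \sum_(j < d) res (a j) i].
Proof.
elim: d a => [|d IHd] a.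
  by rewrite big_ord0; apply: filterS (res_nat 0) => i /= ->; rewrite big_ord0.
pose b j := a (widen_ord (leqnSn d) j).
rewrite big_ord_recr; apply: filterS2 (resD (\sum_(j < d) b j) (a ord_max)) (IHd b).
by move=> i /= -> ->; rewrite big_ord_recr.
Qed.

Lemma resV (x : K) : x != 0 -> F [set i | res x i != 0 /\ res x^-1 i = (res x i)^-1].
Proof.
move=> x0; apply: filterS2 (resM x x^-1) (res_nat 1) => i /=.
rewrite divff // => -> xV.
have rx0 : res x i != 0.
  by apply: contra_eqN xV => /eqP ->; rewrite mul0r eq_sym oner_eq0.
by split=> //; apply: (mulfI rx0); rewrite xV divff.
Qed.

Lemma res_poly_root d (a : 'I_d -> K) (x : K) :
  (x ^+ d + \sum_(j < d) a j * x ^+ j = 0) <->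
  F [set i | res x i ^+ d + \sum_(j < d) res (a j) i * res x i ^+ j = 0].
Proof.
have E : F [set i | res (x ^+ d + \sum_(j < d) a j * x ^+ j) i =
              res x i ^+ d + \sum_(j < d) res (a j) i * res x i ^+ j].
  have resT : F [set i | forall j : 'I_d,
      res (a j * x ^+ j) i = res (a j) i * res x i ^+ j].
    apply: filter_forall => j.
    by apply: filterS2 (resM (a j) (x ^+ j)) (resX x j) => i /= -> ->.
  apply: filterS3 (resD (x ^+ d) (\sum_(j < d) a j * x ^+ j))
    (filterI (resX x d) (res_sum (fun j => a j * x ^+ j))) resT.
  by move=> i /= -> [-> ->] H; congr (_ + _); apply: eq_bigr => j _; rewrite H.
rewrite res_eq; split=> H; apply: filterS3 E H (res_nat 0) => i /=.
  by move=> <- -> ->.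
by move=> -> -> ->.
Qed.

Lemma fQbar_res (x : K) : fQbar x = ucls FU (fun i => fq (P i) (val (res x i))).
Proof.
rewrite -{1}[x]inFp_val fQbarE; apply/ucls_eq.
have /hltE up : hlt (ucls FU (urep (Fp_val x))) p by rewrite urepK; case: (x).
apply: filterS2 (prime_ae p_prime) up => i /= pr_i ui.
have -> : val (res x i) = (urep (Fp_val x) i %% P i)%N by exact: val_Fp_nat.
by rewrite modn_small.
Qed.

End Residues.

(** * The field of elements of complexity in a cut *)

Lemma haddE (I : Type) (F : set_system I) (FU : UltraFilter F) (u v : I -> nat) :
  hadd (ucls FU u) (ucls FU v) = ucls FU (fun i => u i + v i)%N.
Proof. by rewrite /hadd /star !uappE. Qed.

Lemma hmulE (I : Type) (F : set_system I) (FU : UltraFilter F) (u v : I -> nat) :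
  hmul (ucls FU u) (ucls FU v) = ucls FU (fun i => u i * v i)%N.
Proof. by rewrite /hmul /star !uappE. Qed.

(** The existential step of Los's theorem: solutions are chosen pointwise, with 0 where there is
    none. *)
Lemma res_choice (I : Type) (F : set_system I) (FU : UltraFilter F)
    (p : hnat FU) (p_prime : hprime p) (Q : forall i, 'F_(urep p i) -> Prop) :
  F [set i | exists z, Q i z] -> exists x : Fp p_prime, F [set i | Q i (res x i)].
Proof.
move=> exQ; have ex i : exists z : 'F_(urep p i), (exists z, Q i z) -> Q i z.
  have [[z Qz]|nQ] := pselect (exists z, Q i z); first by exists z.
  by exists 0 => /nQ.
have [x xE] := res_ex p_prime (fun i => projT1 (cid (ex i))).
exists x; apply: filterS2 exQ xE => i /= exQ ->.
by case: (cid (ex i)) => z /= /(_ exQ).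
Qed.

Section CutField.
Variables (I : Type) (F : set_system I) (FU : UltraFilter F).
Variables (p : hnat FU) (p_prime : hprime p).
Local Notation K := (Fp p_prime).
Local Notation P i := (urep p i).
Variable C : set (hnat FU).
Hypotheses (cutC : is_cut C) (semiC : is_subsemiring C).

Lemma cut_ae (u v : I -> nat) :
  F [set i | (u i <= v i)%N] -> C (ucls FU v) -> C (ucls FU u).
Proof. by move=> uv; apply: cutC; apply/hleE. Qed.

Lemma cutD (u v : I -> nat) :
  C (ucls FU u) -> C (ucls FU v) -> C (ucls FU (fun i => u i + v i)%N).
Proof. by case: semiC => _ _ CD _ Cu Cv; rewrite -haddE; apply: CD. Qed.

(** The exponent is standard, so closure of [C] under finitely many multiplications suffices. *)
Lemma cut_exp e (u : I -> nat) :
  C (ucls FU u) -> C (ucls FU (fun i => (u i).+2 ^ e)%N).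
Proof.
move=> Cu; have [_ C1 _ CM] := semiC.
elim: e => [|e IHe]; first exact: C1.
have Cu2 : C (ucls FU (fun i => u i + 1 + 1)%N) by apply: cutD => //; apply: cutD.
have := CM _ _ Cu2 IHe; rewrite hmulE; apply: cut_ae.
by apply: filterS filterT => i _ /=; rewrite expnS !addn1.
Qed.

Definition Csmall (x : K) : Prop :=
  exists2 N : I -> nat, C (ucls FU N) & F [set i | small_eig (N i) (res x i)].

Lemma RC_small (x : K) : RC p_prime C x <-> Csmall x.
Proof.
rewrite /RC /preimage /= fQbar_res; split=> [Cx|[N CN Nx]].
  exists (fun i => fq (P i) (val (res x i))) => //.
  apply: filterS (prime_ae p_prime) => i /= pr_i.
  have := fq_small_eig pr_i (leqnn (fq (P i) (val (res x i)))).
  by rewrite natr_Zp.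
apply: cut_ae (cutD CN CN).
apply: filterS2 (prime_ae p_prime) Nx => i /= pr_i Nx.
have {}Nx : small_eig (N i) ((val (res x i))%:R : 'F_(P i)) by rewrite natr_Zp.
exact: small_eig_fq pr_i Nx.
Qed.

Lemma Csmall_ae e (x : K) (N : I -> nat) : C (ucls FU N) ->
  F [set i | small_eig ((N i).+2 ^ e) (res x i)] -> Csmall x.
Proof. by move=> CN Nx; exists (fun i => (N i).+2 ^ e)%N => //; apply: cut_exp. Qed.

Lemma Csmall1 : Csmall 1.
Proof.
have [_ C1 _ _] := semiC; exists (fun=> 1%N) => //.
by apply: filterS (res_nat p_prime 1) => i /= ->; apply: small_eig1.
Qed.

Lemma CsmallN1 : Csmall (-1).
Proof.
have [_ C1 _ _] := semiC; exists (fun=> 1%N) => //.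
apply: filterS (res_int p_prime (-1)) => i /=.
by rewrite mulrN1z => ->; apply: small_eigN1.
Qed.

Lemma Csmall_common d (a : 'I_d -> K) : (forall j, Csmall (a j)) ->
  exists2 N : I -> nat, C (ucls FU N) &
    F [set i | forall j, small_eig (N i) (res (a j) i)].
Proof.
move=> Sa.
have /choice[N HN] : forall j, exists N : I -> nat, C (ucls FU N) /\
    F [set i | small_eig (N i) (res (a j) i)].
  by move=> j; have [N] := Sa j; exists N.
exists (fun i => \sum_j N j i)%N.
  have C0 : C (ucls FU (fun=> 0%N)) by case: semiC.
  suff H (r : seq 'I_d) : C (ucls FU (fun i => \sum_(j <- r) N j i)%N) by apply: H.
  elim: r => [|j r IHr].
    by apply: cut_ae C0; apply: filterS filterT => i _ /=; rewrite big_nil.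
  have [CN _] := HN j; apply: cut_ae (cutD CN IHr).
  by apply: filterS filterT => i _ /=; rewrite big_cons.
apply: filter_forall => j; have [_] := HN j; apply: filterS => i /=.
by apply: small_eig_le; rewrite (bigD1 j) //= leq_addr.
Qed.

Lemma CsmallD (x y : K) : Csmall x -> Csmall y -> Csmall (x + y).
Proof.
move=> [N CN Nx] [N' CN' Ny]; apply: (@Csmall_ae 2 _ _ (cutD CN CN')).
apply: filterS3 (resD x y) Nx Ny => i /= -> Nx Ny.
by apply: small_eigD; [apply: small_eig_le Nx; rewrite leq_addr
                      |apply: small_eig_le Ny; rewrite leq_addl].
Qed.

Lemma CsmallM (x y : K) : Csmall x -> Csmall y -> Csmall (x * y).
Proof.
move=> [N CN Nx] [N' CN' Ny]; apply: (@Csmall_ae 2 _ _ (cutD CN CN')).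
apply: filterS3 (resM x y) Nx Ny => i /= -> Nx Ny.
by apply: small_eigM; [apply: small_eig_le Nx; rewrite leq_addr
                      |apply: small_eig_le Ny; rewrite leq_addl].
Qed.

Lemma CsmallN (x : K) : Csmall x -> Csmall (- x).
Proof. by move=> Sx; rewrite -mulN1r; apply: CsmallM CsmallN1 Sx. Qed.

Lemma Csmall0 : Csmall 0.
Proof. by rewrite -(subrr 1); apply: CsmallD Csmall1 CsmallN1. Qed.

Lemma CsmallV (x : K) : Csmall x -> Csmall x^-1.
Proof.
have [-> _|x0 [N CN Nx]] := eqVneq x 0; first by rewrite invr0; apply: Csmall0.
apply: (@Csmall_ae 4 _ _ CN).
apply: filterS2 (resV x0) Nx => i /= [rx0 ->] Nx.
exact: small_eigV.
Qed.

Lemma Csmall_root d (a : 'I_d -> K) (x : K) : (0 < d)%N ->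
  (forall j, Csmall (a j)) -> x ^+ d + \sum_(j < d) a j * x ^+ j = 0 -> Csmall x.
Proof.
move=> d0 Sa /res_poly_root xa; have [N CN Na] := Csmall_common Sa.
apply: (@Csmall_ae (d * d + d).+2 _ _ CN).
by apply: filterS2 xa Na => i /= xa Na; apply: small_eig_root xa.
Qed.

Lemma Csmall_sqrt (x y : K) : Csmall x -> x = y ^+ 2 -> Csmall y.
Proof.
move=> Sx xy; pose a (j : 'I_2) := if j == 0 then - x else 0.
have Sa j : Csmall (a j).
  by rewrite /a; case: (j == 0); [apply: CsmallN|apply: Csmall0].
apply: (Csmall_root (ltn0Sn 1) Sa).
rewrite big_ord_recr big_ord_recr big_ord0 /a /=.
by rewrite xy mul0r addr0 expr0 mulr1 add0r subrr.
Qed.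

Hypothesis no_sqrtN1 : ~ exists x : K, x ^+ 2 = -1.

Lemma ae_noN1 : F [set i | forall z : 'F_(P i), z ^+ 2 != -1].
Proof.
have [sq|nsq] := in_ultra_setVsetC [set i | exists z : 'F_(P i), z ^+ 2 = -1] FU.
  have [x xE] := res_choice p_prime sq; case: no_sqrtN1; exists x; apply/res_eq.
  apply: filterS3 (resX x 2) xE (res_int p_prime (-1)) => i /= -> ->.
  by rewrite mulrN1z => ->.
by apply: filterS nsq => i /= H z; apply/eqP => zE; apply: H; exists z.
Qed.

(** [finField_sqr_or_opp] holds at almost every index, and the ultrafilter decides which sign
    occurs. *)
Lemma sqr_or_opp (x : K) : exists y : K, x = y ^+ 2 \/ x = - y ^+ 2.
Proof.
have H : F [set i | exists y : 'F_(P i), res x i = y ^+ 2 \/ res x i = - y ^+ 2].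
  by apply: filterS ae_noN1 => i /= /finField_sqr_or_opp.
have [y] := res_choice p_prime H; have sE := resX y 2; have nE := resN (y ^+ 2).
move=> {}H; exists y.
have [xy|xy] := in_ultra_setVsetC [set i | res x i = res y i ^+ 2] FU; [left|right].
  by apply/res_eq; apply: filterS2 sE xy => i /= -> ->.
apply/res_eq; apply: filterS3 H xy (filterI sE nE) => i /= [-> []//|-> _ [sE' ->]].
by rewrite sE'.
Qed.

End CutField.

(** * The conditions [phi] and their thresholds *)

Definition solvable_at (d : nat) (K : fieldType) (a : 'I_d -> K) : Prop :=
  if d == 2 then exists z, \sum_(j < d) a j ^+ 2 = z ^+ 2
  else exists x, x ^+ d + \sum_(j < d) a j * x ^+ j = 0.

Definition phi_at (d q n : nat) : Prop :=
  forall a : 'I_d -> 'F_q, (forall j, fq q (val (a j)) < n)%N -> solvable_at a.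

Section Phi.
Variables (I : Type) (F : set_system I) (FU : UltraFilter F).
Variables (p : hnat FU) (p_prime : hprime p).
Local Notation K := (Fp p_prime).
Local Notation P i := (urep p i).

(** [solvable_at] puts both kinds of condition in one form about [d] elements, so that they can be
    transferred together; for [d = 2] the tuple is the pair of elements being squared. *)
Lemma phiE d (n : hnat FU) : phi p_prime d n <->
  forall a : 'I_d -> K, (forall j, hlt (fQbar (a j)) n) -> solvable_at a.
Proof.
rewrite /phi /solvable_at; have [->|d2] := eqVneq d 2; last by [].
split=> [H a an|H x y xn yn].
  have [z zE] := H (a 0) (a 1) (an 0) (an 1); exists z.
  rewrite big_ord_recr big_ord_recr big_ord0 /= add0r -zE.
  by congr (a _ ^+ 2 + a _ ^+ 2); apply: val_inj.
pose a (j : 'I_2) := if j == 0 then x else y.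
have [|z zE] := H a; first by move=> j; rewrite /a; case: (j == 0).
by exists z; rewrite -zE big_ord_recr big_ord_recr big_ord0 /= add0r.
Qed.

Lemma res_sum_sqr d (a : 'I_d -> K) (z : K) :
  (\sum_(j < d) a j ^+ 2 = z ^+ 2) <->
  F [set i | \sum_(j < d) res (a j) i ^+ 2 = res z i ^+ 2].
Proof.
have resT : F [set i | forall j : 'I_d, res (a j ^+ 2) i = res (a j) i ^+ 2].
  by apply: filter_forall => j; apply: resX.
have E : F [set i | res (\sum_(j < d) a j ^+ 2) i = \sum_(j < d) res (a j) i ^+ 2].
  apply: filterS2 (res_sum (fun j => a j ^+ 2)) resT => i /= -> H.
  by apply: eq_bigr => j _; rewrite H.
rewrite res_eq; split=> H; apply: filterS3 E H (resX z 2) => i /=.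
  by move=> <- -> ->.
by move=> -> -> ->.
Qed.

Lemma solvable_at_res d (a : 'I_d -> K) :
  solvable_at a <-> F [set i | solvable_at (fun j => res (a j) i)].
Proof.
rewrite /solvable_at; case: (d == 2); split.
- move=> [z /res_sum_sqr zE]; apply: filterS zE => i /= zE.
  by exists (res z i).
- by move=> /(res_choice p_prime)[z zE]; exists z; apply/res_sum_sqr.
- move=> [x /res_poly_root xE]; apply: filterS xE => i /= xE.
  by exists (res x i).
- by move=> /(res_choice p_prime)[x xE]; exists x; apply/res_poly_root.
Qed.

Lemma phi_internal d (n : I -> nat) :
  phi p_prime d (ucls FU n) <-> F [set i | phi_at d (P i) (n i)].
Proof.
have hltfE (a : 'I_d -> K) : (forall j, hlt (fQbar (a j)) (ucls FU n)) <->
    F [set i | forall j, fq (P i) (val (res (a j) i)) < n i]%N.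
  split=> [an|an j].
    by apply: filter_forall => j; have := an j; rewrite fQbar_res => /hltE2.
  by rewrite fQbar_res; apply/hltE2; apply: filterS an => i /=.
rewrite phiE; split=> H; last first.
  move=> a /hltfE an; apply/solvable_at_res.
  by apply: filterS2 H an => i /= H; apply: H.
(* A counterexample is chosen at each index where [phi_at] fails; the elements of [K] with these
   components are then tested against [phi]. *)
have ex i : exists a : 'I_d -> 'F_(P i),
    ((forall j, fq (P i) (val (a j)) < n i)%N -> solvable_at a) -> phi_at d (P i) (n i).
  have [Pi|/existsNP[a nPa]] := pselect (phi_at d (P i) (n i)).
    by exists (fun=> 0).
  by exists a => Pa; case: nPa.
have /choice[a aE] : forall j, exists x : K,
    F [set i | res x i = projT1 (cid (ex i)) j].
  by move=> j; apply: (res_ex p_prime (fun i => projT1 (cid (ex i)) j)).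
have {}aE : F [set i | forall j, res (a j) i = projT1 (cid (ex i)) j].
  exact: filter_forall.
have sol := ae_imp FU (fun an => (solvable_at_res a).1 (H a ((hltfE a).2 an))).
apply: filterS2 aE sol => i /=; case: (cid (ex i)) => b /= bP abE sol.
apply: bP => bn; have -> : b = fun j => res (a j) i by apply/funext => j; rewrite abE.
by apply: sol => j; rewrite abE.
Qed.

Hypothesis no_sqrtN1 : ~ exists x : K, x ^+ 2 = -1.

(** This is what bounds the thresholds: for [d = 2] a sum of two squares that is not a square, for
    odd [d] a polynomial [X^d - X + c] without roots. *)
Lemma unsolvable_at_ae d : phi_index d ->
  F [set i | exists a : 'I_d -> 'F_(P i), ~ solvable_at a].
Proof.
move=> dP; apply: filterS2 (prime_ae p_prime) (ae_noN1 no_sqrtN1) => i /= pr_i noN1.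
case/orP: dP => [/eqP ->|/andP[odd_d d_gt1]].
  have [x [y xyz]] := Fp_sum_sqr_not_sqr pr_i noN1.
  exists (fun j => if j == 0 then x else y) => -[z].
  rewrite big_ord_recr big_ord_recr big_ord0 /= add0r => zE.
  by have /eqP := xyz z.
have d2 : (d == 2) = false by apply/eqP => dE; rewrite dE in odd_d.
have [c cP] := finField_rootfree 'F_(P i) d_gt1.
exists (fun j => if val j == 0%N then c else if val j == 1%N then -1 else 0).
rewrite /solvable_at d2 => -[x]; move/eqP: (cP x); apply: contra_not => <-.
move: d d_gt1 {cP odd_d d2} => [|[|d]] // _.
rewrite [in RHS]big_ord_recl [in RHS]big_ord_recl /= expr0 mulr1 expr1 mulN1r.
rewrite [in RHS]big1 ?addr0; last by move=> j _; rewrite mul0r.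
by rewrite -addrA; congr (_ + _); rewrite addrC.
Qed.

(** At almost every index the [n] satisfying [phi_at] are bounded, since a larger one would make an
    unsolvable tuple solvable. By [phi_internal] the class of the pointwise maxima is the greatest
    element. *)
Lemma nhatP d : phi_index d ->
  phi p_prime d (nhat p_prime d) /\
  forall n, phi p_prime d n -> hle n (nhat p_prime d).
Proof.
move=> dP.
have ex i : exists m, (exists a : 'I_d -> 'F_(P i), ~ solvable_at a) ->
    phi_at d (P i) m /\ forall n, phi_at d (P i) n -> (n <= m)%N.
  have [[a na]|na] := pselect (exists a : 'I_d -> 'F_(P i), ~ solvable_at a); last first.
    by exists 0%N => /na.
  have d_gt0 : (0 < d)%N by move: dP; rewrite /phi_index; case: d {a na}.
  pose M := (\max_j fq (P i) (val (a j)))%N.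
  have bnd n : `[< phi_at d (P i) n >] -> (n <= M)%N.
    move=> /asboolP Hn; rewrite leqNgt; apply/negP => Mn; apply: na; apply: Hn => j.
    by apply: leq_ltn_trans Mn; apply: leq_bigmax.
  have ex0 : exists n, `[< phi_at d (P i) n >].
    (* Vacuous: [d] is positive and no complexity is below 0. *)
    exists 0%N; apply/asboolP => b bn; have := bn (Ordinal d_gt0).
    by rewrite ltn0.
  case: (ex_maxnP ex0 bnd) => m /asboolP Pm maxm; exists m => _; split=> // n Pn.
  by apply: maxm; apply/asboolP.
have [m mP] := choice ex.
have mE : F [set i | phi_at d (P i) (m i) /\ forall n, phi_at d (P i) n -> (n <= m i)%N].
  by apply: filterS (unsolvable_at_ae dP) => i /= /mP.
have Pm : phi p_prime d (ucls FU m).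
  by apply/phi_internal; apply: filterS mE => i /= [].
have maxm n : phi p_prime d n -> hle n (ucls FU m).
  rewrite -(urepK n) => /phi_internal Pn; apply/hleE.
  by apply: filterS2 mE Pn => i /= [_ H] /H.
by have -> : nhat p_prime d = ucls FU m by apply: hgreatestE.
Qed.

(** This removes the roots from the description of [Cp]; it rests on the pointwise minimality of the
    ceiling. *)
Lemma hceil_rootP (x n : hnat FU) i : (0 < i)%N ->
  hlt x (hceil_root n i) <-> hlt (hexp x (star FU i)) n.
Proof.
move=> i0; rewrite -(urepK x) -(urepK n); move: (urep x) (urep n) => {}x {}n.
have hexpE (u : I -> nat) : hexp (ucls FU u) (star FU i) = ucls FU (fun j => u j ^ i)%N.
  by rewrite /hexp /star !uappE.
have ex j : exists r, (n j <= r ^ i)%N /\ forall s, (n j <= s ^ i)%N -> (r <= s)%N.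
  apply: nat_least; exists (n j); rewrite -{1}(expn1 (n j)).
  by case: (n j) => // k; rewrite leq_pexp2l.
have [r rP] := choice ex.
have -> : hceil_root (ucls FU n) i = ucls FU r.
  apply: hleastE; rewrite /= ?hexpE.
    by apply/hleE; apply: filterS filterT => j _ /=; have [] := rP j.
  move=> y; rewrite -(urepK y) hexpE => /hleE ny; apply/hleE.
  by apply: filterS ny => j /=; have [_] := rP j; apply.
rewrite hexpE !hltE2; split; apply: filterS => j /=; have [nr minr] := rP j.
  by rewrite !ltnNge; apply: contra => /minr.
rewrite !ltnNge; apply: contra => rx; apply: leq_trans nr _.
by rewrite leq_exp2r.
Qed.

Lemma Cp_lt_nhat d x : phi_index d -> Cp p_prime x -> hlt x (nhat p_prime d).
Proof.
move=> dP /(_ d 1%N dP isT) /hceil_rootP => /(_ isT).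
rewrite -(urepK x) -(urepK (nhat _ _)) /hexp /star !uappE => /hltE2 H.
by apply/hltE2; apply: filterS H => i /=; rewrite expn1.
Qed.

Theorem RC_real_closed (C : set (hnat FU)) :
  is_cut C -> is_subsemiring C -> C `<=` Cp p_prime ->
  is_real_closed_field (RC p_prime C) (@Fle I F FU p p_prime).
Proof.
move=> cutC semiC CCp.
have RCE x : RC p_prime C x <-> Csmall C x by apply: RC_small.
have lt_nhat d x : phi_index d -> RC p_prime C x -> hlt (fQbar x) (nhat p_prime d).
  by move=> dP Cx; apply: Cp_lt_nhat => //; apply: CCp.
apply: real_closed_subfield.
- by apply/RCE/Csmall1.
- move=> x y /RCE Sx /RCE Sy; apply/RCE.
  exact: (CsmallD cutC semiC Sx (CsmallN cutC semiC Sy)).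
- move=> x y /RCE Sx /RCE Sy; apply/RCE.
  exact: (CsmallM cutC semiC Sx (CsmallV cutC semiC Sy)).
- by move=> x; apply/eqP => xE; apply: no_sqrtN1; exists x.
- move=> x /RCE Sx; have [y xy] := sqr_or_opp no_sqrtN1 x; exists y; last exact: xy.
  apply/RCE; case: xy => xy; first exact: (Csmall_sqrt cutC semiC Sx xy).
  have xyN : - x = y ^+ 2 by rewrite xy opprK.
  exact: (Csmall_sqrt cutC semiC (CsmallN cutC semiC Sx) xyN).
- move=> x y Sx Sy; have [H _] := nhatP (isT : phi_index 2).
  by apply: H; apply: (lt_nhat 2%N).
- move=> d a odd_d Sa.
  (* [phi] provides a root in [Fp] only; the monic equation that it satisfies bounds its
     complexity. *)
  have Sr x : x ^+ d + \sum_(i < d) a i * x ^+ i = 0 -> RC p_prime C x.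
    have d_gt0 : (0 < d)%N by case: (d) odd_d.
    have Sa' j : Csmall C (a j) by apply/RCE.
    by move=> xa; apply/RCE; apply: (Csmall_root cutC semiC d_gt0 Sa' xa).
  (* Degree 1 has no condition [phi] attached to it; the root is [- a ord0]. *)
  have [d_le1|d_gt1] := leqP d 1.
    have d1 : d = 1%N by case: (d) odd_d d_le1 => [|[]].
    subst d.
    have xa : (- a ord0) ^+ 1 + \sum_(i < 1) a i * (- a ord0) ^+ i = 0.
      by rewrite big_ord1 expr0 expr1 mulr1 addNr.
    by exists (- a ord0); [apply: Sr|].
  have dP : phi_index d by rewrite /phi_index odd_d d_gt1 orbT.
  have [+ _] := nhatP dP; rewrite /phi.
  have -> : (d == 2) = false by apply/eqP => dE; rewrite dE in odd_d.
  move=> /(_ a (fun j => lt_nhat d (a j) dP (Sa j)))[x xa].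
  by exists x; [apply: Sr|].
Qed.

End Phi.

(** * Elements of standard complexity *)

(** With size exactly [N], the matrices in question range over one finite set. *)
Lemma small_eig_square (L : fieldType) N (x : L) : small_eig N x ->
  exists k (M : 'M[int]_N), [/\ (k <= 2 ^ N)%N, k%:R != 0 :> L,
    forall i j, `|M i j| <= 2 ^+ N & eigenvalue (map_mx intr M : 'M[L]_N) (k%:R * x)].
Proof.
move=> /small_eig_pad[k [v [A [kN k0 AN [t vt] vA]]]].
exists k, (\matrix_(i, j) A i j); split; rewrite ?kN //.
  by move=> i j; rewrite mxE.
apply/eigenvalueP; exists (\row_i v i).
  by apply/rowP => j; rewrite !mxE -vA; apply: eq_bigr => i _; rewrite !mxE.
by apply: contraNneq vt => /rowP/(_ t); rewrite !mxE => ->.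
Qed.

Lemma monic_root_sum (L : fieldType) N (chi : {poly int}) (y : L) :
  chi \is monic -> size chi = N.+1 ->
  root (map_poly intr chi) y <-> y ^+ N + \sum_(j < N) (chi`_j)%:~R * y ^+ j = 0.
Proof.
move=> mon sz.
have -> : y ^+ N + \sum_(j < N) (chi`_j)%:~R * y ^+ j = (map_poly intr chi).[y].
  rewrite (@horner_coef_wide _ N.+1) ?(leq_trans (size_poly _ _)) ?sz //.
  rewrite big_ord_recr addrC /=; congr (_ + _).
    by apply: eq_bigr => j _; rewrite coef_map.
  have cN : chi`_N = 1 by rewrite -(monicP mon) lead_coefE sz.
  by rewrite coef_map /= cN mul1r.
by split=> /rootP.
Qed.

Lemma ae_finite (I : Type) (F : set_system I) (FU : UltraFilter F) (T : finType)
  (Q : I -> T -> Prop) : F [set i | exists t, Q i t] -> exists t, F [set i | Q i t].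
Proof.
move=> exQ; apply: contrapT => nQ.
have : F [set i | forall t, ~ Q i t].
  apply: filter_forall => t.
  have [Qt|//] := in_ultra_setVsetC [set i | Q i t] FU.
  by case: nQ; exists t.
move=> {}nQ; apply: (@filter_not_empty _ F).
by apply: filterS2 exQ nQ => i /= [t Qt] /(_ t).
Qed.

Section Standard.
Variables (I : Type) (F : set_system I) (FU : UltraFilter F).
Variables (p : hnat FU) (p_prime : hprime p).
Local Notation K := (Fp p_prime).
Local Notation P i := (urep p i).

(** For standard [N] there are finitely many pairs of a denominator and an integer matrix, so a
    single pair works on a set of the ultrafilter; the characteristic polynomial of that matrix
    vanishes at [k x]. *)
Lemma standard_algebraic (x : K) (N : nat) : hlt (fQbar x) (star FU N) ->
  exists k (chi : {poly int}), [/\ (0 < k)%N, chi \is monic &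
    root (map_poly intr chi) (k%:R * x)].
Proof.
rewrite fQbar_res => /hltE2 xN.
pose T := ('I_(2 ^ N).+1 * 'M['I_(2 ^ N + 2 ^ N).+1]_N)%type.
(* Entries between [- 2 ^ N] and [2 ^ N] are coded by ordinals, shifted by [2 ^ N]. *)
pose mx (t : T) : 'M[int]_N := \matrix_(i, j) ((t.2 i j)%:Z - (2 ^ N)%:Z).
have : F [set i | exists t : T, (0 < t.1)%N /\
    eigenvalue (map_mx intr (mx t) : 'M['F_(P i)]_N) (t.1%:R * res x i)].
  apply: filterS2 (prime_ae p_prime) xN => i /= pr_i xN.
  have := fq_small_eig pr_i (ltnW xN); rewrite natr_Zp => /small_eig_square.
  move=> [k [M [kN k0 MN eigM]]].
  have Mlt a b : (absz (M a b + (2 ^ N)%N%:Z)%R < (2 ^ N + 2 ^ N).+1)%N.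
    have := MN a b; rewrite -[2]/(2%:R) -natrX natz; lia.
  exists (@Ordinal (2 ^ N).+1 k kN, \matrix_(a, b) Ordinal (Mlt a b)); split=> /=.
    by rewrite lt0n; apply: contraNneq k0 => ->.
  set M' := mx _; suff -> : M' = M by [].
  apply/matrixP => a b; rewrite !mxE /=.
  have := MN a b; rewrite -[2]/(2%:R) -natrX natz; lia.
move=> /(ae_finite FU)[t tP].
have [i0 [k_gt0 _]] := filter_ex tP.
exists t.1, (char_poly (mx t)); split=> //; first exact: char_poly_monic.
pose chi := char_poly (mx t).
have mon : chi \is monic by apply: char_poly_monic.
have sz : size chi = N.+1 by rewrite size_char_poly.
apply/(monic_root_sum _ mon sz)/res_poly_root.
have coefE : F [set i | forall j : 'I_N, res ((chi`_j)%:~R : K) i = (chi`_j)%:~R].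
  by apply: filter_forall => j; apply: res_int.
apply: filterS3 tP coefE (filterI (resM t.1%:R x) (res_nat p_prime t.1)).
move=> i /= [_ eigM] coefE [-> ->].
have : root (map_poly intr chi) ((t.1%:R : 'F_(P i)) * res x i).
  by rewrite map_char_poly -eigenvalue_root_char.
move=> /(monic_root_sum _ mon sz) H; rewrite -[RHS]H; congr (_ + _).
by apply: eq_bigr => j _; rewrite coefE.
Qed.

Hypothesis no_sqrtN1 : ~ exists x : K, x ^+ 2 = -1.
Variable h : {rmorphism realalg -> K}.

Lemma standard_in_image (x : K) (N : nat) : hlt (fQbar x) (star FU N) ->
  exists b, x = h b.
Proof.
move=> /standard_algebraic[k [chi [k_gt0 mon chix]]].
have noN1 (z : K) : z ^+ 2 != -1.
  by apply/eqP => zE; apply: no_sqrtN1; exists z.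
have sqrtR (y : realalg) : 0 <= y -> exists z, z ^+ 2 = y.
  by move=> y0; exists (Num.sqrt y); rewrite sqr_sqrtr.
have oddR (q : {poly realalg}) : q \is monic -> ~~ odd (size q) -> exists z, root q z.
  by move=> _ /odd_poly_root[z qz]; exists z.
have chi0 : map_poly intr chi != 0 :> {poly realalg}.
  by apply: monic_neq0; apply: monic_map.
have [|b kb] := sqr_neqN1_image sqrtR oddR noN1 (y := k%:R * x) chi0 (h := h).
  rewrite -map_poly_comp (eq_map_poly (g := intr)) //.
  by move=> z; apply: rmorph_int.
exists (b / k%:R).
have k0 : k%:R != 0 :> realalg by rewrite pnatr_eq0 -lt0n.
have hk0 : k%:R != 0 :> K by rewrite -(rmorph_nat h) fmorph_eq0.
by rewrite rmorphM fmorphV rmorph_nat -kb mulrC mulKf.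
Qed.

(** All the [a j] come from real algebraic numbers, where the equation is solvable; [h] carries the
    solution over. *)
Lemma phi_standard d (N : nat) : phi_index d -> phi p_prime d (star FU N).
Proof.
move=> dP; apply/phiE => a aN.
have /choice[b bE] : forall j, exists b, a j = h b.
  by move=> j; apply: standard_in_image (aN j).
rewrite /solvable_at; have [d2|d2] := eqVneq d 2.
  exists (h (Num.sqrt (\sum_j b j ^+ 2))); rewrite -rmorphXn sqr_sqrtr; last first.
    by apply: sumr_ge0 => j _; rewrite sqr_ge0.
  by rewrite rmorph_sum; apply: eq_bigr => j _; rewrite bE rmorphXn.
have odd_d : odd d by move: dP; rewrite /phi_index (negPf d2) => /andP[].
pose q : {poly realalg} := 'X^d + \poly_(j < d) (if insub j is Some j' then b j' else 0).
have szq : size q = d.+1.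
  by rewrite size_polyDl ?size_polyXn // ltnS size_poly.
have [|z /rootP qz] := @odd_poly_root _ q; first by rewrite szq /= odd_d.
exists (h z); transitivity (h q.[z]); last by rewrite qz rmorph0.
rewrite hornerD hornerXn rmorphD rmorphXn.
congr (_ + _); rewrite horner_poly rmorph_sum.
by apply: eq_bigr => j _; rewrite valK rmorphM rmorphXn bE.
Qed.

Lemma Cp_cut : is_cut (Cp p_prime).
Proof.
move=> x y xy Cy d i dP i1; apply/hltNge => le_root.
by have /hltNge := Cy d i dP i1; apply; apply: hle_trans le_root xy.
Qed.

Lemma CpP (x : I -> nat) : Cp p_prime (ucls FU x) <->
  forall d i, phi_index d -> (0 < i)%N -> F [set j | (x j ^ i < urep (nhat p_prime d) j)%N].
Proof.
have E d i : (0 < i)%N -> hlt (ucls FU x) (hceil_root (nhat p_prime d) i) <->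
    F [set j | (x j ^ i < urep (nhat p_prime d) j)%N].
  move=> i0; rewrite hceil_rootP // -{1}(urepK (nhat p_prime d)).
  by rewrite /hexp /star !uappE hltE2.
by split=> H d i dP i0; apply/E => //; apply: H.
Qed.

(** The standard number [n ^ i + 1] satisfies [phi], so [n ^ i] is below the threshold. *)
Lemma Cp_standard (n : nat) : Cp p_prime (star FU n).
Proof.
apply/CpP => d i dP i0; have [_ maxn] := nhatP no_sqrtN1 dP.
have := maxn _ (phi_standard (n ^ i).+1 dP).
by rewrite -{1}(urepK (nhat p_prime d)) => /hleE.
Qed.

(** Membership at exponent [2 i] bounds [x ^ (2 i)] and [y ^ (2 i)] by the threshold, so the square
    of [(x y) ^ i] is below the square of the threshold. *)
Lemma Cp_mul (x y : hnat FU) : Cp p_prime x -> Cp p_prime y -> Cp p_prime (hmul x y).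
Proof.
rewrite -(urepK x) -(urepK y) hmulE => /CpP Cx /CpP Cy; apply/CpP => d i dP i0.
have i2 : (0 < i * 2)%N by rewrite muln_gt0 i0.
apply: filterS2 (Cx d _ dP i2) (Cy d _ dP i2) => j /=.
rewrite !expnM => xN yN; rewrite -(ltn_exp2r _ _ (ltn0Sn 1)) expnMn expnMn.
by rewrite -[X in (_ < X)%N]mulnn ltn_mul.
Qed.

Lemma Cp_subsemiring : is_subsemiring (Cp p_prime).
Proof.
split; [exact: Cp_standard|exact: Cp_standard| |exact: Cp_mul].
(* A sum is at most twice its larger term, and 2 is standard, so addition reduces to
   multiplication. *)
have CpD (u v : I -> nat) : F [set i | (u i <= v i)%N] ->
    Cp p_prime (ucls FU v) -> Cp p_prime (ucls FU (fun i => u i + v i)%N).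
  move=> uv /(Cp_mul (Cp_standard 2)); rewrite /star hmulE; apply: Cp_cut.
  by apply/hleE; apply: filterS uv => i /= uv; rewrite mul2n -addnn leq_add2r.
move=> x y; rewrite -(urepK x) -(urepK y) haddE; move: (urep x) (urep y) => u v Cu Cv.
have [uv|vu] := in_ultra_setVsetC [set i | (u i <= v i)%N] FU; first exact: CpD.
have -> : (fun i => u i + v i)%N = (fun i => v i + u i)%N.
  by apply/funext => i; rewrite addnC.
apply: CpD Cu; apply: filterS vu => i /= /negP; rewrite -ltnNge; exact: ltnW.
Qed.

End Standard.

Theorem theorem4p8 (I : Type) (F : set_system I) (FU : UltraFilter F)
    (F_incomplete : countably_incomplete F)
    (p : hnat FU) (p_prime : hprime p)
    (p_nonstandard : forall n : nat, p <> star FU n)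
    (real_algebraic_subfield : inhabited {rmorphism realalg -> Fp p_prime})
    (no_sqrtN1 : ~ exists x : Fp p_prime, x ^+ 2 = -1) :
  (forall C : set (hnat FU),
     is_cut C -> is_subsemiring C -> C `<=` Cp p_prime ->
     is_real_closed_field (RC p_prime C) (@Fle I F FU p p_prime)) /\
  is_real_closed_field (RC p_prime (Cp p_prime)) (@Fle I F FU p p_prime).
Proof.
have [h] := real_algebraic_subfield.
split=> [C|]; first exact: RC_real_closed.
apply: RC_real_closed => //; first exact: Cp_cut.
exact: Cp_subsemiring no_sqrtN1 h.
Qed.
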